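(* Let $\alpha>0$ be fixed. Then for every sufficiently large $N\geq1$, \[ \max_{\sqrt{N}\leq \ell\leq N\log N}\left|\zeta(1+i\alpha\ell)\right|\;\geq\; e^{\gamma}\bigl(\log\log N+\log\log\log N+O(1)\bigr), \] where the maximum is over integers $\ell$ in the indicated range, $\gamma$ is the Euler–Mascheroni constant, and the $O(1)$ term is bounded in absolute value by a constant depending only on $\alpha$.
   Context: $\zeta$ denotes the Riemann zeta function. *)

(* Defs.v *)
From Stdlib Require Import Reals Lra.
From Coquelicot Require Import Coquelicot.
Open Scope R_scope.

Definition cpow_neg (n : nat) (s : C) : C :=
  (Rpower (INR n) (- Re s) * cos (Im s * ln (INR n)),
   - (Rpower (INR n) (- Re s) * sin (Im s * ln (INR n)))).

Definition zeta_approx (s : C) (N : nat) : C :=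
  Cminus (sum_n_m (fun n => cpow_neg n s) 1 N)
         (Cdiv (Cmult (RtoC (INR N)) (cpow_neg N s)) (Cminus 1 s)).

(* Riemann zeta function, via its standard analytic continuation to
   Re s > 0, s <> 1:  zeta(s) = lim_{N->oo} (sum_{n<=N} n^{-s} - N^{1-s}/(1-s)).
   (Values outside Re s > 0, s <> 1 are irrelevant.) *)
Definition zeta (s : C) : C :=
  (real (Lim_seq (fun N => Re (zeta_approx s N))),
   real (Lim_seq (fun N => Im (zeta_approx s N)))).

Definition euler_gamma : R :=
  real (Lim_seq (fun n => sum_n_m (fun k => / INR k) 1 n - ln (INR n))).

(* Main.v *)
(* The resonance method with Fejer weights.  For weights [w_l = L - |l|], [|l| < L], the
   functions [f] with [sum_l w_l f(l) e^(i th l) >= 0] for every [th] form a cone that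
   contains 1 and is stable under multiplication by a character and by
   [1 / (1 - q e^(i a l))], [0 <= q < 1].  Let [q_p = 1 - p/Z] for primes [p <= Z], extended
   completely multiplicatively, and [R(l) = prod_(p <= Z) |1 - q_p p^(i alpha l)|^(-2)].
   Since [p^(-it) - q_p = p^(-it) (1 - q_p p^(it))] cancels a factor of [R], all the
   functions [(k^(-i alpha l) - q_k) R(l)] lie in the cone.  Hence the [w R]-mean of
   [sum_(k <= X) k^(-1 - i alpha l)] is at least [Q = sum_(k <= X) q_k / k], which for large
   [X] is about [prod_(p <= Z) (1 - q_p/p)^(-1) >= e^gamma (log Z - O(1))] by Mertens.
   Taking [Z] of size [log N loglog N] keeps [R] below a small power of [N], so the terms
   with [|l| < sqrt N] (including the pole at [l = 0]) do not matter.

   The lower bound in Mertens' third theorem is obtained without identifying the constant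
   through the Gamma function: [log prod_(p <= y) (1 - 1/p)^(-1) <= loglog y + b] for all
   [y >= x] gives an upper bound for [log zeta(1 + s)] by partial summation against
   [sum_m r^m / m = - log (1 - r)], [r = 2^(-s)], whose partial sums at [r = 1] are at least
   [log m + gamma]; comparing with [zeta(1 + s) >= 1/s] as [s -> 0] forces [b >= gamma]. *)
Require Import Defs.
From Stdlib Require Import Reals Lra Lia Classical.
From Coquelicot Require Import Coquelicot.
From HB Require Import structures.
From mathcomp Require all_boot zify.
Open Scope R_scope.

(* MathComp is imported only inside this section, so that [<=] on [nat] in the theorem
   below is Stdlib's. *)
Section LargeValues.
Import mathcomp.boot.all_boot mathcomp.zify.zify.
Local Open Scope R_scope.

Local Notation "\sum_ ( m <= i < n | P ) F" :=
  (\big[Rplus/0]_(m <= i < n | P%B) F) : R_scope.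
Local Notation "\sum_ ( m <= i < n ) F" :=
  (\big[Rplus/0]_(m <= i < n) F) : R_scope.

(** * Finite sums of reals *)

HB.instance Definition _ := Monoid.isComLaw.Build R 0 Rplus
  (fun x y z => esym (Rplus_assoc x y z)) Rplus_comm Rplus_0_l.
HB.instance Definition _ := Monoid.isComLaw.Build R 1 Rmult
  (fun x y z => esym (Rmult_assoc x y z)) Rmult_comm Rmult_1_l.

Lemma INR_addn (m n : nat) : INR (m + n)%N = INR m + INR n.
Proof. exact: plus_INR. Qed.

Lemma INR_muln (m n : nat) : INR (m * n)%N = INR m * INR n.
Proof. exact: mult_INR. Qed.

Lemma INR_expn (m n : nat) : INR (expn m n) = INR m ^ n.
Proof. by elim: n => [|n IH] //; rewrite expnS INR_muln IH. Qed.

Lemma INR_leq (m n : nat) : (m <= n)%N -> INR m <= INR n.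
Proof. by move/leP/le_INR. Qed.

Lemma INR_ltn (m n : nat) : (m < n)%N -> INR m < INR n.
Proof. by move/ltP/lt_INR. Qed.

Lemma INR_gt0 (n : nat) : (0 < n)%N -> 0 < INR n.
Proof. by move/INR_ltn. Qed.

Lemma INR_ge1 (n : nat) : (0 < n)%N -> 1 <= INR n.
Proof. by move/INR_leq. Qed.

Lemma INR_ge2 (n : nat) : (1 < n)%N -> 2 <= INR n.
Proof. by move/INR_leq. Qed.

Lemma ln_ge0 (x : R) : 1 <= x -> 0 <= ln x.
Proof. move=> h; rewrite -ln_1; apply: ln_le => //; lra. Qed.

(** The default value of [ln] at 0 keeps [ln (INR n)] nonnegative for every natural [n], so index 0
    needs no exception later. *)
Lemma ln_zero : ln 0 = 0.
Proof. by rewrite /ln; case: Rlt_dec => [h|//]; case: (Rlt_irrefl 0). Qed.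

Lemma ln_INR_ge0 (n : nat) : 0 <= ln (INR n).
Proof.
case: n => [|n]; last by apply/ln_ge0/INR_ge1.
by rewrite /= ln_zero; lra.
Qed.

Lemma ln_le_sub1 (x : R) : 0 < x -> ln x <= x - 1.
Proof. by move=> h; have := exp_ineq1_le (ln x); rewrite exp_ln //; lra. Qed.

Lemma ln_div (x y : R) : 0 < x -> 0 < y -> ln (x / y) = ln x - ln y.
Proof.
move=> hx hy; rewrite /Rdiv ln_mult //; last exact: Rinv_0_lt_compat.
by rewrite ln_Rinv //; lra.
Qed.

Lemma ln_ge_1_inv (x : R) : 0 < x -> 1 - / x <= ln x.
Proof.
move=> hx; have := ln_le_sub1 (/ x) (Rinv_0_lt_compat _ hx).
by rewrite ln_Rinv //; lra.
Qed.

Lemma exp_le (x y : R) : x <= y -> exp x <= exp y.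
Proof. by case=> [/exp_increasing|->]; lra. Qed.

Lemma ln_pow_nat (x : R) (n : nat) : 0 < x -> ln (x ^ n) = INR n * ln x.
Proof.
move=> hx; elim: n => [|n IH]; first by rewrite /= ln_1; lra.
by rewrite S_INR [_ ^ _]/= ln_mult ?IH //; [lra | apply: pow_lt].
Qed.

Lemma ln2_ge_half : 1/2 <= ln 2.
Proof. by have := ln_ge_1_inv 2; lra. Qed.

Lemma ln2_le1 : ln 2 <= 1.
Proof. by have := ln_le_sub1 2; lra. Qed.

Lemma rsum_le (m n : nat) (P : pred nat) (F G : nat -> R) :
  (forall i, (m <= i < n)%N -> P i -> F i <= G i) ->
  \sum_(m <= i < n | P i) F i <= \sum_(m <= i < n | P i) G i.
Proof.
move=> H; rewrite big_nat_cond [X in _ <= X]big_nat_cond.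
apply: (big_ind2 (fun x y => x <= y)); first lra.
  by move=> *; lra.
by move=> i /andP[h1 h2]; apply: H.
Qed.

Lemma rsum_ge0 (m n : nat) (P : pred nat) (F : nat -> R) :
  (forall i, (m <= i < n)%N -> P i -> 0 <= F i) ->
  0 <= \sum_(m <= i < n | P i) F i.
Proof.
move=> H; rewrite big_nat_cond; apply: (big_ind (fun x => 0 <= x)); first lra.
  by move=> *; lra.
by move=> i /andP[h1 h2]; apply: H.
Qed.

Lemma rsum_scal (c : R) (m n : nat) (P : pred nat) (F : nat -> R) :
  c * (\sum_(m <= i < n | P i) F i) = \sum_(m <= i < n | P i) (c * F i).
Proof.
apply: (big_ind2 (fun x y => c * x = y)) => //; first lra.
by move=> x1 x2 y1 y2 <- <-; lra.
Qed.

Lemma rsum_split (m n : nat) (P : pred nat) (F G : nat -> R) :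
  \sum_(m <= i < n | P i) (F i + G i)
  = \sum_(m <= i < n | P i) F i + \sum_(m <= i < n | P i) G i.
Proof. exact: big_split. Qed.

Lemma rsum_sub (m n : nat) (P : pred nat) (F G : nat -> R) :
  \sum_(m <= i < n | P i) (F i - G i)
  = \sum_(m <= i < n | P i) F i - \sum_(m <= i < n | P i) G i.
Proof.
rewrite big_split /=; congr (_ + _).
by apply: (big_ind2 (fun x y => x = - y)) => //; [lra | move=> x1 x2 y1 y2 -> ->; lra].
Qed.

Lemma rsum_recr (m n : nat) (P : pred nat) (F : nat -> R) : (m <= n)%N ->
  \sum_(m <= i < n.+1 | P i) F i
  = \sum_(m <= i < n | P i) F i + (if P n then F n else 0).
Proof. by move=> h; rewrite big_mkcond big_nat_recr //= -big_mkcond. Qed.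

Lemma rsum_nat_recr (m n : nat) (F : nat -> R) : (m <= n)%N ->
  \sum_(m <= i < n.+1) F i = \sum_(m <= i < n) F i + F n.
Proof. exact: rsum_recr. Qed.

Lemma rsum_const (m n : nat) (c : R) : (m <= n)%N ->
  \sum_(m <= i < n) c = (INR n - INR m) * c.
Proof.
move/subnK=> <-; elim: (n - m)%N => [|k IH]; first by rewrite add0n big_geq //; lra.
by rewrite addSn rsum_recr ?leq_addl //= IH -/(INR (k + m).+1) S_INR; lra.
Qed.

Lemma rsum_cond_le (m n : nat) (P : pred nat) (F : nat -> R) :
  (forall i, (m <= i < n)%N -> 0 <= F i) ->
  \sum_(m <= i < n | P i) F i <= \sum_(m <= i < n) F i.
Proof.
move=> H; rewrite big_mkcond; apply: rsum_le => i hi _.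
by case: ifP => // _; [lra | apply: H].
Qed.

Lemma rsum_telescope (m n : nat) (F : nat -> R) : (m <= n)%N ->
  \sum_(m <= i < n) (F i.+1 - F i) = F n - F m.
Proof.
move/subnK=> <-; elim: (n - m)%N => [|k IH]; first by rewrite add0n big_geq //; lra.
by rewrite addSn rsum_recr ?leq_addl //= IH; lra.
Qed.

Lemma rsum_widen (m n p : nat) (P : pred nat) (F : nat -> R) : (m <= n <= p)%N ->
  (forall i, (n <= i < p)%N -> P i -> 0 <= F i) ->
  \sum_(m <= i < n | P i) F i <= \sum_(m <= i < p | P i) F i.
Proof.
move=> /andP[h1 h2] H; rewrite (big_cat_nat h1 h2) /=.
by have := rsum_ge0 n p P F H; lra.
Qed.

(** * Chebyshev's bound and Mertens' first theorem *)

Lemma INR_dvdn_prime (p : nat) : prime p -> 2 <= INR p.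
Proof. by move/prime_gt1/INR_ge2. Qed.

(** Logarithm of the prime factorization: [m] is first a product over all [i <= B + m], where
    non-primes have exponent 0; the factors with [i >= B] are then trivial. *)
Lemma ln_decomp (m B : nat) : (0 < m)%N ->
  (forall p, prime p -> (p %| m)%N -> (p < B)%N) ->
  ln (INR m) = \sum_(0 <= p < B | prime p) (INR (logn p m) * ln (INR p)).
Proof.
move=> m0 hB.
pose F p := INR (logn p m) * ln (INR p).
have F0 p : ~~ prime p -> F p = 0 by rewrite /F lognE => /negbTE -> /=; lra.
have -> : ln (INR m) = \sum_(0 <= p < (B + m).+1) F p.
  have hm : (m <= B + m)%N by rewrite leq_addl.
  rewrite -{1}(partnT m0) (widen_partn _ hm).
  rewrite (eq_bigl predT) //.
  have: 0 < INR (\prod_(0 <= i < (B + m).+1) expn i (logn i m)) /\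
    ln (INR (\prod_(0 <= i < (B + m).+1) expn i (logn i m)))
    = \sum_(0 <= p < (B + m).+1) F p; last by case.
  apply: (big_rec2 (fun x y => 0 < INR x /\ ln (INR x) = y)).
    by rewrite /= ln_1; split; lra.
  move=> i x y _ [hx <-].
  have hi : 0 < INR (expn i (logn i m)).
    apply: INR_gt0; rewrite expn_gt0; case: (posnP i) => //= ->.
    by rewrite lognE.
  rewrite INR_muln ln_mult //; split; first exact: Rmult_lt_0_compat.
  congr (_ + _); rewrite /F INR_expn.
  case: (posnP i) => [->|i0]; first by rewrite lognE /= ln_1; lra.
  by rewrite ln_pow_nat //; apply: INR_gt0.
rewrite (@big_cat_nat _ _ _ B) //=; last by lia.
rewrite [X in _ + X]big_nat [X in _ + X]big1 => [|p /andP[hp _]].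
  rewrite Rplus_0_r [RHS]big_mkcond /=.
  by apply: eq_bigr => p _; case: ifP => // /negbT/F0.
rewrite /F lognE; case: ifP => [/and3P[h1 _ h3]|_] /=; last by lra.
by have := hB p h1 h3; lia.
Qed.

Definition theta (n : nat) : R := \sum_(0 <= p < n.+1 | prime p) ln (INR p).

(** For odd [n = 2m + 1] the two equal middle coefficients add up to at most [2^n], so each is at
    most [4^m]. The exponent [n - uphalf n] is exactly what the induction in [theta_le] can
    spend. *)
Lemma bin_uphalf_le (n : nat) : ('C(n, uphalf n) <= expn 4 (n - uphalf n))%N.
Proof.
have sub (N k : nat) : (k <= N)%N -> ('C(N, k) <= expn 2 N)%N.
  move=> hk; have hk' : (k < N.+1)%N by [].
  have := expnDn 1 1 N; rewrite addn1 => ->.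
  rewrite (bigD1 (Ordinal hk')) //= !exp1n !muln1; exact: leq_addr.
case: (boolP (odd n)) => ho; last first.
  apply: leq_trans (sub _ _ _) _; first by lia.
  by rewrite -(expnM 2 2) leq_exp2l //; lia.
have [m ->] : exists m, n = m.*2.+1 by exists n./2; lia.
have -> : uphalf m.*2.+1 = m.+1 by lia.
have -> : (m.*2.+1 - m.+1 = m)%N by lia.
have h1 : (m.+1 < m.*2.+2)%N by lia.
have h2 : (m < m.*2.+2)%N by lia.
have hs : 'C(m.*2.+1, m) = 'C(m.*2.+1, m.+1).
  by rewrite -bin_sub; [congr ('C(_, _)); lia | lia].
have := expnDn 1 1 m.*2.+1; rewrite addn1.
rewrite (bigD1 (Ordinal h1)) //= (bigD1 (Ordinal h2)) /=; last first.
  by apply/eqP => -[]; lia.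
have -> : expn 2 m.*2.+1 = (2 * expn 4 m)%N by rewrite -mul2n expnS expnM.
rewrite !exp1n !muln1 hs; set s := bigop _ _ _; lia.
Qed.

(** Strong induction with [h = uphalf n]: a prime in [(h, n]] divides [n!] but neither [h!] nor
    [(n - h)!], hence divides the binomial coefficient, so [theta n - theta h] is at most its
    logarithm. *)
Lemma theta_le (n : nat) : theta n <= INR n * ln 4.
Proof.
have ln4 : 0 <= ln 4 by apply: ln_ge0; lra.
elim/ltn_ind: n => n IH.
case: (leqP n 1) => hn1.
  rewrite /theta big_nat_cond big1; first by have := pos_INR n; nra.
  by move=> p /andP[/andP[_ h1] /prime_gt1]; lia.
set h := uphalf n; have hh : (h < n)%N by rewrite /h; lia.
have hb0 : (0 < 'C(n, h))%N by rewrite bin_gt0; lia.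
have step : \sum_(h.+1 <= p < n.+1 | prime p) ln (INR p) <= ln (INR 'C(n, h)).
  rewrite (@ln_decomp _ ('C(n, h) + n).+2) //; last first.
    by move=> p _ /(dvdn_leq hb0); lia.
  apply: Rle_trans (_ : \sum_(h.+1 <= p < n.+1 | prime p)
      (INR (logn p 'C(n, h)) * ln (INR p)) <= _).
    apply: rsum_le => p /andP[hp1 hp2] pp.
    have pd : (p %| 'C(n, h))%N.
      have : (p %| n`!)%N by rewrite dvdn_fact // prime_gt0 //=; lia.
      rewrite -(@bin_fact n h) ?Euclid_dvdM //; last by lia.
      case/or3P => // hd; exfalso.
        have : logn p h`! = 0%N.
          rewrite logn_fact // big_nat_cond big1 // => k /andP[/andP[k0 _] _].
          apply: divn_small; apply: leq_trans hp1 _.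
          by rewrite -{1}(expn1 p) leq_exp2l ?prime_gt1.
        by move/eqP; rewrite -leqn0 leqNgt logn_gt0 mem_primes pp fact_gt0 hd.
      have : logn p (n - h)`! = 0%N.
        rewrite logn_fact // big_nat_cond big1 // => k /andP[/andP[k0 _] _].
        apply: divn_small; apply: (@leq_trans p); first by rewrite /h in hp1 *; lia.
        by rewrite -{1}(expn1 p) leq_exp2l ?prime_gt1.
      by move/eqP; rewrite -leqn0 leqNgt logn_gt0 mem_primes pp fact_gt0 hd.
    have : (0 < logn p 'C(n, h))%N by rewrite logn_gt0 mem_primes pp hb0.
    by move/INR_ge1; have := ln_INR_ge0 p; nra.
  have hnn : (n.+1 <= ('C(n, h) + n).+2)%N by lia.
  have hhh : (h.+1 <= n.+1)%N by lia.
  have nn i : 0 <= INR (logn i 'C(n, h)) * ln (INR i).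
    by apply: Rmult_le_pos; [exact: pos_INR | exact: ln_INR_ge0].
  have h0 : (0 <= h.+1)%N by [].
  rewrite (@big_cat_nat _ _ _ h.+1 0 _ _ _ h0) /=; last by lia.
  have := rsum_ge0 0 h.+1 prime _ (fun i _ _ => nn i).
  suff : \sum_(h.+1 <= p < n.+1 | prime p) (INR (logn p 'C(n, h)) * ln (INR p))
    <= \sum_(h.+1 <= p < ('C(n, h) + n).+2 | prime p)
         (INR (logn p 'C(n, h)) * ln (INR p)) by lra.
  by apply: rsum_widen => //; lia.
have e : theta n = theta h + \sum_(h.+1 <= p < n.+1 | prime p) ln (INR p).
  by rewrite /theta (@big_cat_nat _ _ _ h.+1) //; lia.
have hC : ln (INR 'C(n, h)) <= (INR n - INR h) * ln 4.
  have -> : INR n - INR h = INR (n - h)%N.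
    by rewrite -{1}(@subnK h n) ?INR_addn; [lra | lia].
  have -> : 4 = INR 4 by rewrite /=; lra.
  rewrite -ln_pow_nat -?INR_expn; last by apply: INR_gt0.
  apply: ln_le; first exact: INR_gt0.
  by apply: INR_leq; apply: bin_uphalf_le.
by have := IH h hh; lra.
Qed.

Lemma ln_fact_rec (n : nat) : ln (INR n.+1`!) = ln (INR n.+1) + ln (INR n`!).
Proof.
rewrite factS INR_muln ln_mult //; apply: INR_gt0 => //; exact: fact_gt0.
Qed.

Lemma ln_fact_lb (n : nat) : INR n * ln (INR n) - INR n <= ln (INR n`!).
Proof.
elim: n => [|n IH]; first by rewrite /= ln_1; lra.
rewrite ln_fact_rec.
case: n IH => [|n] IH; first by rewrite /= ln_1; lra.
have n0 : 0 < INR n.+1 by apply: INR_gt0.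
have hS : INR n.+2 = INR n.+1 + 1 by rewrite S_INR.
have := ln_le_sub1 (INR n.+2 / INR n.+1).
rewrite ln_div //; last by apply: INR_gt0.
have -> : INR n.+2 / INR n.+1 - 1 = / INR n.+1 by rewrite hS; field; lra.
move=> h.
have {}h : ln (INR n.+2) - ln (INR n.+1) <= / INR n.+1.
  by apply: h; apply: Rdiv_lt_0_compat => //; lra.
have h2 : INR n.+1 * (ln (INR n.+2) - ln (INR n.+1)) <= 1.
  by have := Rmult_le_compat_l _ _ _ (Rlt_le _ _ n0) h; rewrite Rinv_r; lra.
by rewrite hS in h2 *; lra.
Qed.

Lemma ln_fact_ub (n : nat) : ln (INR n`!) <= INR n * ln (INR n).
Proof.
elim: n => [|n IH]; first by rewrite /= ln_1; lra.
rewrite ln_fact_rec S_INR.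
have : INR n * ln (INR n) <= INR n * ln (INR n + 1).
  case: n {IH} => [|n]; first by rewrite /=; lra.
  apply: Rmult_le_compat_l; first exact: pos_INR.
  by apply: ln_le; [exact: INR_gt0 | lra].
lra.
Qed.

(** Only the first term [n %/ p] of Legendre's formula is kept. *)
Lemma logn_fact_lb (p n : nat) : prime p -> INR n / INR p - 1 <= INR (logn p n`!).
Proof.
move=> pp; have p2 := INR_dvdn_prime p pp.
case: n => [|n]; first by have := pos_INR (logn p 0`!); rewrite /Rdiv [INR 0]/= Rmult_0_l; lra.
rewrite logn_fact // big_ltn // expn1 INR_addn.
have := pos_INR (\sum_(2 <= i < n.+2) n.+1 %/ expn p i).
have : INR n.+1 < (INR (n.+1 %/ p) + 1) * INR p.
  rewrite -S_INR -INR_muln; apply: INR_ltn.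
  by rewrite -ltn_divLR // prime_gt0.
move=> h1 h2.
have : INR n.+1 / INR p < INR (n.+1 %/ p) + 1 by apply/Rlt_div_l; lra.
lra.
Qed.

(** Multiplied by [p - 1], the term of index [k] in Legendre's formula is at most
    [n / p^(k-1) - n / p^k], which telescopes. *)
Lemma logn_fact_ub (p n : nat) : prime p -> INR (logn p n`!) <= INR n / (INR p - 1).
Proof.
move=> pp; have p2 := INR_dvdn_prime p pp.
have pw k : 0 < INR p ^ k by apply: pow_lt; lra.
rewrite logn_fact //.
have -> : INR (\sum_(1 <= k < n.+1) n %/ expn p k)
   = \sum_(1 <= k < n.+1) INR (n %/ expn p k).
  apply: (big_morph INR) => //; exact: INR_addn.
apply/Rle_div_r; first by lra.
apply: Rle_trans (_ : \sum_(1 <= k < n.+1) (INR n / INR p ^ k.-1 - INR n / INR p ^ k) <= _).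
  rewrite Rmult_comm rsum_scal; apply: rsum_le => k /andP[k0 _] _.
  have : INR (n %/ expn p k) * INR p ^ k <= INR n.
    by rewrite -INR_expn -INR_muln; apply: INR_leq; apply: leq_divM.
  case: k k0 => // k _; rewrite /= => h.
  have -> : INR n / INR p ^ k - INR n / (INR p * INR p ^ k)
    = (INR p - 1) * (INR n / (INR p * INR p ^ k)).
    by have hk := pw k; field; lra.
  apply: Rmult_le_compat_l; first lra.
  apply/Rle_div_r => //; exact: pw k.+1.
rewrite big_add1 /=.
rewrite (eq_bigr (fun k => - (INR n / INR p ^ k.+1) - - (INR n / INR p ^ k))); last first.
  by move=> k _ /=; lra.
rewrite (rsum_telescope 0 n (fun k => - (INR n / INR p ^ k))) //.
have : 0 <= INR n / INR p ^ n.
  by apply: Rdiv_le_0_compat => //; exact: pos_INR.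
by rewrite [INR p ^ 0]/=; lra.
Qed.

Lemma ln_fact_decomp (n : nat) :
  ln (INR n`!) = \sum_(0 <= p < n.+1 | prime p) (INR (logn p n`!) * ln (INR p)).
Proof.
apply: ln_decomp; first exact: fact_gt0.
move=> p pp hd; rewrite ltnS leqNgt; apply/negP => hp.
have : (0 < logn p n`!)%N by rewrite logn_gt0 mem_primes pp fact_gt0.
rewrite logn_fact // big_nat_cond big1 // => k /andP[/andP[k0 _] _].
apply: divn_small; apply: leq_trans hp _.
by rewrite -{1}(expn1 p) leq_exp2l ?prime_gt1.
Qed.

Definition mertens1 (n : nat) : R :=
  \sum_(0 <= p < n.+1 | prime p) (ln (INR p) / INR p).

Lemma ln4_le2 : ln 4 <= 2.
Proof.
have -> : 4 = 2 ^ 2 by lra.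
by rewrite ln_pow_nat /=; have := ln2_le1; lra.
Qed.

(** [ln n!] is at most [n ln n] and, by [logn_fact_lb], at least [n * mertens1 n - theta n];
    Chebyshev's bound with [ln 4 <= 2] finishes. *)
Lemma mertens1_ub (n : nat) : (0 < n)%N -> mertens1 n <= ln (INR n) + 2.
Proof.
move=> n0; have n0' := INR_gt0 n n0.
have h : INR n * mertens1 n - theta n <= INR n * ln (INR n).
  apply: Rle_trans (ln_fact_ub n); rewrite ln_fact_decomp /mertens1 /theta.
  rewrite rsum_scal -rsum_sub; apply: rsum_le => p _ pp.
  have := logn_fact_lb p n pp; have := ln_INR_ge0 p; have := INR_dvdn_prime p pp.
  move=> h1 h2 h3.
  by have := Rmult_le_compat_r _ _ _ h2 h3; rewrite /Rdiv; lra.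
have := theta_le n; have := ln4_le2 => h1 h2.
by apply: (Rmult_le_reg_l (INR n)) => //; nra.
Qed.

(** The decrease of [(ln x + 2) / x] from [n] to [n + 1] is at least the new summand, so the
    explicit right-hand side carries the induction. The sum measures the cost of replacing
    [1/(p - 1)] by [1/p]. *)
Lemma sum_ln_over_sq (n : nat) : (0 < n)%N ->
  \sum_(2 <= k < n.+1) (ln (INR k) / (INR k * (INR k - 1)))
    <= 2 - (ln (INR n) + 2) / INR n.
Proof.
elim: n => // n IH _; case: n IH => [|n] IH.
  by rewrite big_geq //= ln_1; lra.
rewrite rsum_recr //=; have {}IH := IH isT.
rewrite -/(INR n.+2) -/(INR n.+1).
have n1 : 1 <= INR n.+1 by apply: INR_ge1.
have hS : INR n.+2 = INR n.+1 + 1 by rewrite S_INR.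
rewrite hS; set x := INR n.+1 in n1 IH *.
suff : ln (x + 1) / ((x + 1) * (x + 1 - 1))
   <= (ln x + 2) / x - (ln (x + 1) + 2) / (x + 1) by lra.
have h := ln_le_sub1 ((x + 1) / x).
rewrite ln_div in h; try lra.
have {}h : ln (x + 1) - ln x <= / x.
  have -> : / x = (x + 1) / x - 1 by field; lra.
  by apply: h; apply: Rdiv_lt_0_compat; lra.
have hx : / x <= 1 by rewrite -Rinv_1; apply: Rinv_le_contravar; lra.
have hx2 : (x + 1) * / x = 1 + / x by field; lra.
have hh : (x + 1) * (ln (x + 1) - ln x) <= 2.
  by have := Rmult_le_compat_l (x + 1) _ _ _ h; lra.
have -> : (ln x + 2) / x - (ln (x + 1) + 2) / (x + 1)
   = ((x + 1) * ln x - x * ln (x + 1) + 2) / ((x + 1) * (x + 1 - 1)).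
  by field; lra.
apply: Rmult_le_compat_r; last by lra.
by apply: Rlt_le; apply: Rinv_0_lt_compat; nra.
Qed.

(** The lower bound for [ln n!] is set against [1/(p - 1) = 1/p + 1/(p (p - 1))]; the second part
    contributes at most 2, whence [3 = 1 + 2]. *)
Lemma mertens1_lb (n : nat) : (0 < n)%N -> ln (INR n) - 3 <= mertens1 n.
Proof.
move=> n0; have n0' := INR_gt0 n n0.
have hs : \sum_(0 <= p < n.+1 | prime p) (ln (INR p) / (INR p * (INR p - 1))) <= 2.
  have h2 : \sum_(2 <= p < n.+1) (ln (INR p) / (INR p * (INR p - 1))) <= 2.
    apply: Rle_trans (sum_ln_over_sq n n0) _.
    have : 0 <= (ln (INR n) + 2) / INR n.
      by apply: Rdiv_le_0_compat => //; have := ln_INR_ge0 n; lra.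
    lra.
  apply: Rle_trans h2; rewrite big_mkcond big_ltn // big_ltn //=.
  rewrite !Rplus_0_l; apply: rsum_le => p /andP[p2 _] _.
  case: ifP => _; first by lra.
  have := INR_ge2 p p2 => p2'.
  by apply: Rdiv_le_0_compat; [exact: ln_INR_ge0 | nra].
have h : INR n * ln (INR n) - INR n <= INR n * (mertens1 n + 2).
  apply: Rle_trans (ln_fact_lb n) _; rewrite ln_fact_decomp.
  apply: Rle_trans (Rmult_le_compat_l (INR n) _ _ (Rlt_le _ _ n0')
     (Rplus_le_compat_l (mertens1 n) _ _ hs)).
  rewrite /mertens1 -rsum_split rsum_scal; apply: rsum_le => p _ pp.
  have p2 := INR_dvdn_prime p pp.
  have := Rmult_le_compat_r _ _ _ (ln_INR_ge0 p) (logn_fact_ub p n pp).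
  move/Rle_trans; apply; apply: Req_le; field; lra.
by apply: (Rmult_le_reg_l (INR n)) => //; lra.
Qed.

(** * Mertens' second theorem, one-sided *)

Definition ln_mertens (n : nat) : R :=
  \sum_(0 <= p < n.+1 | prime p) - ln (1 - / INR p).

(** Partial summation without integrals. The increment of [T] is a nonpositive term, by
    [1 - 1/v <= ln v], plus [Er n (1/ln n - 1/ln (n+1))] with [Er n <= 2]. The constant is
    [5 = 2 + 3], from the two halves of Mertens' first theorem. *)
Lemma prime_recip_ub (x y : nat) : (2 <= x <= y)%N ->
  (\sum_(0 <= p < y.+1 | prime p) / INR p) - ln (ln (INR y))
  <= (\sum_(0 <= p < x.+1 | prime p) / INR p) - ln (ln (INR x)) + 5 / ln (INR x).
Proof.
move=> /andP[hx hxy].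
pose R1 n := \sum_(0 <= p < n.+1 | prime p) / INR p.
pose Er n := mertens1 n - ln (INR n).
pose T n := R1 n - ln (ln (INR n)) - Er n / ln (INR n).
have lnpos n : (1 < n)%N -> 0 < ln (INR n).
  by move=> /INR_ge2 h; rewrite -ln_1; apply: ln_increasing; lra.
have hT : T y <= T x + 2 / ln (INR x) - 2 / ln (INR y).
  move: hxy => /subnK <-; elim: (y - x)%N => [|k IH]; first by rewrite add0n; lra.
  rewrite addSn; set n := (k + x)%N in IH *.
  have n2 : (1 < n)%N by rewrite /n; lia.
  have l0 := lnpos n n2.
  have l1 := lnpos n.+1 (leqW n2).
  suff : T n.+1 - T n <= 2 / ln (INR n) - 2 / ln (INR n.+1) by lra.
  have hR : R1 n.+1 - R1 n = (mertens1 n.+1 - mertens1 n) / ln (INR n.+1).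
    rewrite /R1 /mertens1 (rsum_recr 0 n.+1) // (rsum_recr 0 n.+1 _ (fun p => ln (INR p) / INR p)) //.
    have hn := INR_gt0 n.+1 isT.
    by case: ifP => _; field; lra.
  have hln : (ln (INR n.+1) - ln (INR n)) / ln (INR n.+1)
      <= ln (ln (INR n.+1)) - ln (ln (INR n)).
    rewrite -(ln_div (ln (INR n.+1))) //.
    apply: Rle_trans (ln_ge_1_inv _ _); last exact: Rdiv_lt_0_compat.
    by apply: Req_le; field; lra.
  have hE : Er n <= 2 by rewrite /Er; have := mertens1_ub n (ltnW n2); lra.
  have hle : / ln (INR n.+1) <= / ln (INR n).
    apply: Rinv_le_contravar => //; apply: ln_le; first by apply: INR_gt0; lia.
    exact: INR_leq.
  have -> : T n.+1 - T n = ((ln (INR n.+1) - ln (INR n)) / ln (INR n.+1)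
      - (ln (ln (INR n.+1)) - ln (ln (INR n))))
      + Er n * (/ ln (INR n) - / ln (INR n.+1)).
    rewrite /T.
    have -> : R1 n.+1 = R1 n + (mertens1 n.+1 - mertens1 n) / ln (INR n.+1) by lra.
    by rewrite /Er; field; lra.
  by rewrite /Rdiv in hln *; nra.
have lx := lnpos x hx.
have ly := lnpos y (leq_trans hx hxy).
have h1 : Er y / ln (INR y) <= 2 / ln (INR y).
  apply: Rmult_le_compat_r; first by apply: Rlt_le; apply: Rinv_0_lt_compat.
  by rewrite /Er; have := mertens1_ub y (ltnW (leq_trans hx hxy)); lra.
have h2 : - 3 / ln (INR x) <= Er x / ln (INR x).
  apply: Rmult_le_compat_r; first by apply: Rlt_le; apply: Rinv_0_lt_compat.
  by rewrite /Er; have := mertens1_lb x (ltnW hx); lra.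
move: hT; rewrite /T -/(R1 y) -/(R1 x); lra.
Qed.

(** Each prime [p = n + 1] above [x] adds at most [1/n - 1/(n+1)] to the difference between
    [- ln (1 - 1/p)] and [1/p]; the total telescopes below [1/x <= 1/ln x]. *)
Lemma ln_mertens_ub (x y : nat) : (2 <= x <= y)%N ->
  ln_mertens y - ln (ln (INR y)) <= ln_mertens x - ln (ln (INR x)) + 6 / ln (INR x).
Proof.
move=> hxy; have h := prime_recip_ub x y hxy; case/andP: hxy => hx hxy.
suff h2 : ln_mertens y - \sum_(0 <= p < y.+1 | prime p) / INR p
   <= ln_mertens x - \sum_(0 <= p < x.+1 | prime p) / INR p + / INR x - / INR y.
  have hy : 0 <= / INR y.
    by apply/Rlt_le/Rinv_0_lt_compat/INR_gt0; lia.
  have hx' : / INR x <= / ln (INR x).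
    have x2 := INR_ge2 x hx.
    apply: Rinv_le_contravar; last by have := ln_le_sub1 (INR x) ltac:(lra); lra.
    by rewrite -ln_1; apply: ln_increasing; lra.
  by rewrite /Rdiv in h *; lra.
move: {h} hxy => /subnK <-; elim: (y - x)%N => [|k IH]; first by rewrite add0n; lra.
rewrite addSn; set n := (k + x)%N in IH *.
rewrite /ln_mertens (rsum_recr 0 n.+1) // (rsum_recr 0 n.+1 _ (fun p => / INR p)) //.
rewrite -/(ln_mertens n) -/(ln_mertens x).
have n2 : (1 < n)%N by rewrite /n; lia.
have n1 : 1 < INR n by have := INR_ge2 n n2; lra.
have hS : INR n.+1 = INR n + 1 by rewrite S_INR.
have hi : / INR n.+1 <= / INR n by apply: Rinv_le_contravar; lra.
case: ifP => _; last by lra.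
have h1 : 1 - / INR n.+1 = INR n / INR n.+1 by rewrite hS; field; lra.
have : - ln (1 - / INR n.+1) <= / INR n.
  rewrite -ln_Rinv h1; last by apply: Rdiv_lt_0_compat; lra.
  apply: Rle_trans (ln_le_sub1 _ _) _.
    by apply: Rinv_0_lt_compat; apply: Rdiv_lt_0_compat; lra.
  by apply: Req_le; rewrite hS; field; lra.
lra.
Qed.

(** * Sums over smooth numbers and Euler products *)

(** The bound is strict and [z] need not be prime: inductions on [z] admit one candidate prime at a
    time, and [smooth z.+1] allows the primes up to [z]. *)
Definition smooth (z k : nat) : bool := all (fun p => p < z)%N (primes k).

Lemma smooth_lt (z k : nat) : (0 < k < z)%N -> smooth z k.
Proof.
move=> /andP[k0 kz]; apply/allP => p; rewrite mem_primes => /and3P[_ _ hd].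
by apply: leq_ltn_trans kz; apply: dvdn_leq.
Qed.

Lemma smoothS_nprime (z k : nat) : ~~ prime z -> smooth z.+1 k = smooth z k.
Proof.
move=> hz; apply: eq_in_all => p; rewrite mem_primes => /and3P[pp _ _].
rewrite ltnS leq_eqVlt; case: eqP => //= e.
by rewrite -e pp in hz.
Qed.

Lemma smoothS_dvd (z k : nat) : prime z -> (0 < k)%N ->
  smooth z.+1 (z * k) = smooth z.+1 k.
Proof.
move=> pz k0; apply/allP/allP => H p hp.
  by apply: H; rewrite primesM ?(prime_gt0 pz) // hp orbT.
move: hp; rewrite primesM ?(prime_gt0 pz) // => /orP[|/H //].
by rewrite primes_prime // inE => /eqP ->.
Qed.

Lemma smoothS_ndvd (z k : nat) : prime z -> (0 < k)%N ->
  smooth z k = smooth z.+1 k && ~~ (z %| k)%N.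
Proof.
move=> pz k0; apply/allP/andP => [H|[/allP H hd] p hp].
  split; first by apply/allP => p /H; lia.
  apply/negP => hd; have : z \in primes k by rewrite mem_primes pz k0.
  by move/H; rewrite ltnn.
have := H p hp; rewrite ltnS leq_eqVlt => /orP[/eqP e|//].
by move: hp; rewrite e mem_primes (negbTE hd) !andbF.
Qed.

Lemma sum_multiples (z X : nat) (P : pred nat) (g : nat -> R) : (0 < z)%N ->
  \sum_(1 <= k < X.+1 | P k && (z %| k)%N) g k
  = \sum_(1 <= m < (X %/ z).+1 | P (z * m)%N) g (z * m)%N.
Proof.
move=> z0; elim: X => [|X IH]; first by rewrite div0n !big_geq.
rewrite rsum_recr // IH divnS //; case: (boolP (z %| X.+1)%N) => hd.
  have e : (z * (X %/ z).+1 = X.+1)%N.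
    by have := divnS X z0; rewrite hd add1n => <-; rewrite mulnC divnK.
  by rewrite add1n (rsum_recr 1 (X %/ z).+1) // e andbT.
by rewrite add0n andbF; lra.
Qed.

Definition smooth_sum (f : nat -> R) (z X : nat) : R :=
  \sum_(1 <= k < X.+1 | smooth z k) f k.

(** Complete multiplicativity in the form used by the recursion on primes; the value at 0 is left
    free. *)
Definition prime_mult (f : nat -> R) : Prop :=
  forall p m, prime p -> (0 < m)%N -> f (p * m)%N = f p * f m.

(** The sum is split by divisibility by [z]; the multiples [z m <= X] correspond to [m <= X %/ z].
    Both Euler product bounds rest on this identity. *)
Lemma smooth_sum_rec (f : nat -> R) (z X : nat) : prime_mult f -> prime z ->
  smooth_sum f z.+1 X = smooth_sum f z X + f z * smooth_sum f z.+1 (X %/ z).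
Proof.
move=> fm pz; rewrite /smooth_sum (bigID (fun k => ~~ (z %| k)%N)) /=; congr (_ + _).
  rewrite big_nat_cond [RHS]big_nat_cond; apply: eq_bigl => k.
  case: (boolP (1 <= k < X.+1)%N) => //= /andP[k0 _].
  by rewrite (smoothS_ndvd z k).
rewrite (eq_bigl (fun k => smooth z.+1 k && (z %| k)%N)); last by move=> k; rewrite negbK.
rewrite sum_multiples ?prime_gt0 // rsum_scal big_nat_cond [RHS]big_nat_cond.
apply: eq_big => [k|k /andP[/andP[k0 _] _]]; last exact: fm.
by case: (boolP (1 <= k < (X %/ z).+1)%N) => //= /andP[k0 _]; rewrite smoothS_dvd.
Qed.

Lemma smooth_sum_nprime (f : nat -> R) (z X : nat) : ~~ prime z ->
  smooth_sum f z.+1 X = smooth_sum f z X.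
Proof. by move=> hz; apply: eq_bigl => k; rewrite smoothS_nprime. Qed.

Lemma smooth_sum0 (f : nat -> R) (X : nat) : (0 < X)%N -> smooth_sum f 0 X = f 1%N.
Proof.
move=> X0; rewrite /smooth_sum big_mkcond big_ltn //= big_nat big1; first by lra.
move=> k /andP[k1 _]; case: ifP => // /allP /(_ (pdiv k)).
by rewrite mem_primes pdiv_prime // pdiv_dvd (ltnW k1) => /(_ isT).
Qed.

Lemma smooth_sum_ge0 (f : nat -> R) (z X : nat) :
  (forall k, 0 <= f k) -> 0 <= smooth_sum f z X.
Proof. by move=> f0; apply: rsum_ge0. Qed.

Lemma smooth_sum_mono (f : nat -> R) (z X Y : nat) :
  (forall k, 0 <= f k) -> (X <= Y)%N -> smooth_sum f z X <= smooth_sum f z Y.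
Proof. by move=> f0 h; apply: rsum_widen => //; lia. Qed.

Lemma smooth_sum_full (f : nat -> R) (X : nat) :
  smooth_sum f X.+1 X = \sum_(1 <= k < X.+1) f k.
Proof.
rewrite /smooth_sum big_mkcond; apply: eq_big_nat => k hk.
by rewrite smooth_lt.
Qed.

Definition ln_euler (f : nat -> R) (z : nat) : R :=
  \sum_(0 <= p < z | prime p) - ln (1 - f p).

Lemma ln_eulerS (f : nat -> R) (z : nat) :
  ln_euler f z.+1 = ln_euler f z + (if prime z then - ln (1 - f z) else 0).
Proof. exact: rsum_recr. Qed.

Lemma exp_neg_ln (x : R) : 0 < x -> exp (- ln x) = / x.
Proof. by move=> h; rewrite exp_Ropp exp_ln. Qed.

(** Enlarging [X %/ z] to [X] in [smooth_sum_rec] gives [S' <= S + f(z) S'], which is solved for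
    [S']. *)
Lemma smooth_sum_ub (f : nat -> R) (z X : nat) : prime_mult f ->
  (forall k, 0 <= f k) -> f 1%N = 1 -> (forall p, prime p -> f p < 1) ->
  (0 < X)%N -> smooth_sum f z X <= exp (ln_euler f z).
Proof.
move=> fm f0 f1 fp X0; elim: z => [|z IH].
  by rewrite smooth_sum0 // f1 /ln_euler big_geq // exp_0; lra.
rewrite ln_eulerS; case: (boolP (prime z)) => pz; last first.
  by rewrite smooth_sum_nprime // Rplus_0_r.
have h1 := fp z pz.
rewrite exp_plus exp_neg_ln; last by lra.
apply/Rle_div_r; first by lra.
have : smooth_sum f z.+1 X <= smooth_sum f z X + f z * smooth_sum f z.+1 X.
  rewrite {1}smooth_sum_rec //; apply: Rplus_le_compat_l.
  by apply: Rmult_le_compat_l => //; apply: smooth_sum_mono => //; apply: leq_div.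
lra.
Qed.

(** The quotient is the geometric sum of [f(z)^e] over [e < E]; each further exponent of [z]
    enlarges the cut-off by a factor [z]. *)
Lemma smooth_sum_lb1 (f : nat -> R) (z X E : nat) : prime_mult f ->
  (forall k, 0 <= f k) -> prime z -> f z < 1 ->
  smooth_sum f z X * ((1 - f z ^ E) / (1 - f z)) <= smooth_sum f z.+1 (X * expn z E).
Proof.
move=> fm f0 pz h1; elim: E => [|E IH].
  rewrite [_ ^ 0]/=; have -> : (1 - 1) / (1 - f z) = 0 by field; lra.
  by rewrite Rmult_0_r; apply: smooth_sum_ge0.
rewrite smooth_sum_rec // expnS.
have -> : ((X * (z * expn z E)) %/ z = X * expn z E)%N.
  by rewrite mulnCA mulKn // prime_gt0.
have h2 : smooth_sum f z X <= smooth_sum f z (X * (z * expn z E)).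
  apply: smooth_sum_mono => //; rewrite leq_pmulr // muln_gt0 expn_gt0.
  by rewrite prime_gt0.
have h3 := Rmult_le_compat_l _ _ _ (f0 z) IH.
apply: Rle_trans (Rplus_le_compat _ _ _ _ h2 h3).
by apply: Req_le; rewrite [_ ^ E.+1]/=; field; lra.
Qed.

(* [E] bounds the exponents of the primes that are kept. *)
Lemma smooth_sum_lb (f : nat -> R) (z E : nat) (d : R) : prime_mult f ->
  (forall k, 0 <= f k) -> f 1%N = 1 -> (forall p, prime p -> f p < 1) ->
  0 < d < 1 -> (forall p, prime p -> f p ^ E <= d) ->
  exp (ln_euler f z + INR z * ln (1 - d)) <= smooth_sum f z (expn z (z * E)).
Proof.
move=> fm f0 f1 fp hd hE.
(* Every [w < z], prime or not, is charged a factor [1 - d] in the sum and [z^E] in the cut-off. *)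
suff H w : (w <= z)%N ->
    exp (ln_euler f w + INR w * ln (1 - d)) <= smooth_sum f w (expn z (w * E)).
  exact: H.
elim: w => [|w IH] hw.
  rewrite mul0n expn0 smooth_sum0 // f1 /ln_euler big_geq // [INR 0]/=.
  by rewrite Rmult_0_l Rplus_0_r exp_0; lra.
have ld : ln (1 - d) <= 0 by have := ln_le_sub1 (1 - d) ltac:(lra); lra.
have z0 : (0 < z)%N by apply: leq_trans hw.
have {}IH := IH (ltnW hw).
rewrite ln_eulerS S_INR mulSn addnC expnD.
case: (boolP (prime w)) => pw; last first.
  rewrite smooth_sum_nprime // Rplus_0_r.
  apply: Rle_trans (smooth_sum_mono f w (expn z (w * E)) _ f0 _).
    apply: Rle_trans IH; apply: exp_le; lra.
  by rewrite leq_pmulr // expn_gt0 z0.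
have hm : smooth_sum f w.+1 (expn z (w * E) * expn w E)
   <= smooth_sum f w.+1 (expn z (w * E) * expn z E).
  apply: smooth_sum_mono => //; rewrite leq_mul2l; apply/orP; right.
  case: (posnP E) => [->|E0]; first by rewrite !expn0.
  by rewrite leq_exp2r //; lia.
apply: Rle_trans hm.
apply: Rle_trans (smooth_sum_lb1 f w _ E fm f0 pw (fp w pw)).
have h1 := fp w pw.
have -> : ln_euler f w + - ln (1 - f w) + (INR w + 1) * ln (1 - d)
  = (ln_euler f w + INR w * ln (1 - d)) + (ln (1 - d) + - ln (1 - f w)) by lra.
rewrite exp_plus; apply: Rmult_le_compat => //; try by apply/Rlt_le/exp_pos.
rewrite exp_plus exp_neg_ln ?exp_ln; [|lra|lra].
apply: Rmult_le_compat_r; first by apply/Rlt_le/Rinv_0_lt_compat; lra.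
by have := hE w pw; lra.
Qed.

(** * Mertens' third theorem, lower bound *)

Definition harmonic (n : nat) : R := \sum_(1 <= k < n.+1) / INR k.

Lemma harmonicS (n : nat) : harmonic n.+1 = harmonic n + / INR n.+1.
Proof. exact: rsum_recr. Qed.

Lemma sum_n_m_big (f : nat -> R) (n : nat) :
  sum_n_m f 1 n = \sum_(1 <= k < n.+1) f k.
Proof.
elim: n => [|n IH]; first by rewrite sum_n_m_zero ?big_geq //; lia.
rewrite sum_n_Sm; last by lia.
by rewrite IH [in RHS]rsum_recr.
Qed.

Lemma ln_succ_ub (n : nat) : (0 < n)%N -> ln (INR n.+1) - ln (INR n) <= / INR n.
Proof.
move=> n0; have h := INR_gt0 n n0; have h' := INR_gt0 n.+1 isT.
rewrite -ln_div //; apply: Rle_trans (ln_le_sub1 _ _) _; first exact: Rdiv_lt_0_compat.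
by apply: Req_le; rewrite S_INR; field; lra.
Qed.

Lemma ln_succ_lb (n : nat) : (0 < n)%N -> / INR n.+1 <= ln (INR n.+1) - ln (INR n).
Proof.
move=> n0; have h := INR_gt0 n n0; have h' := INR_gt0 n.+1 isT.
rewrite -ln_div //; apply: Rle_trans (ln_ge_1_inv _ _); last exact: Rdiv_lt_0_compat.
by apply: Req_le; rewrite S_INR in h' *; field; lra.
Qed.

Lemma harmonic_ge_ln (n : nat) : (0 < n)%N -> ln (INR n.+1) <= harmonic n.
Proof.
elim: n => // n IH _; case: n IH => [|n] IH.
  rewrite /harmonic big_nat1 /=; have := ln2_le1.
  by rewrite Rinv_1 (_ : 1 + 1 = 2); lra.
by rewrite harmonicS; have := IH isT; have := ln_succ_ub n.+2 isT; lra.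
Qed.

Lemma harmonic_le_ln (n : nat) : (0 < n)%N -> harmonic n <= 1 + ln (INR n).
Proof.
elim: n => // n IH _; case: n IH => [|n] IH.
  by rewrite /harmonic big_nat1 /= Rinv_1 ln_1; lra.
by rewrite harmonicS; have := IH isT; have := ln_succ_lb n.+1 isT; lra.
Qed.

(** [harmonic n - ln n] decreases for [n >= 1], so its limit bounds it from below. *)
Lemma euler_gamma_spec :
  0 <= euler_gamma /\
  forall n, (0 < n)%N -> ln (INR n) + euler_gamma <= harmonic n.
Proof.
(* The shift matters: the value at index 0, with [ln 0 = 0], would be 0 and break monotonicity. *)
pose u n := harmonic n.+1 - ln (INR n.+1).
have decr n : u n.+1 <= u n.
  by rewrite /u (harmonicS n.+1); have := ln_succ_lb n.+1 isT; lra.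
have pos n : 0 <= u n.
  by have := harmonic_ge_ln n.+1 isT; have := ln_succ_lb n.+1 isT;
    have := Rinv_0_lt_compat _ (INR_gt0 n.+2 isT); rewrite /u; lra.
have [l hl] := ex_finite_lim_seq_decr u 0 decr pos.
have -> : euler_gamma = l.
  rewrite /euler_gamma -Lim_seq_incr_1.
  rewrite (Lim_seq_ext _ u); first by rewrite (is_lim_seq_unique _ _ hl).
  by move=> n; rewrite sum_n_m_big.
split.
  have := is_lim_seq_le (fun=> 0) u 0 l pos (is_lim_seq_const 0) hl.
  by [].
case=> // n _; have := is_lim_seq_decr_compare u l hl decr n.
by rewrite /u; lra.
Qed.

(** The difference [phi] vanishes at 0 and has derivative [y^M / (1 - y) >= 0] on [[0, x]]. *)
Lemma sum_pow_div_le (x : R) (M : nat) : 0 <= x < 1 ->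
  \sum_(1 <= m < M.+1) (x ^ m / INR m) <= - ln (1 - x).
Proof.
move=> [x0 x1].
pose phi y := - ln (1 - y) - \sum_(1 <= m < M.+1) (y ^ m / INR m).
have dphi y : y < 1 -> is_derive phi y (y ^ M / (1 - y)).
  move=> hy; rewrite /phi; elim: (M) => [|n IH].
    apply: (is_derive_ext (fun y => - ln (1 - y))).
      by move=> t; rewrite big_geq // Rminus_0_r.
    by auto_derive; [lra | rewrite /=; field; lra].
  apply: (is_derive_ext (fun y => (- ln (1 - y) - \sum_(1 <= m < n.+1) (y ^ m / INR m))
      - y ^ n.+1 / INR n.+1)).
    by move=> t; rewrite [in RHS]rsum_recr //; lra.
  have -> : y ^ n.+1 / (1 - y) = y ^ n / (1 - y) - y ^ n by rewrite /=; field; lra.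
  apply: (is_derive_minus _ _ _ _ _ IH).
  have hn := INR_gt0 n.+1 isT.
  by auto_derive => //; rewrite -/(INR n.+1); field; lra.
have phi0 : phi 0 = 0.
  rewrite /phi big_nat big1; first by rewrite !Rminus_0_r ln_1; lra.
  move=> m /andP[m1 _]; case: m m1 => // m _.
  by rewrite /= Rmult_0_l /Rdiv Rmult_0_l.
suff : 0 <= phi x by rewrite /phi; lra.
have [c [hc e]] := MVT_gen phi 0 x (fun y => y ^ M / (1 - y))
  (fun y hy => dphi y (ltac:(move: hy; rewrite /Rmin /Rmax; case: Rle_dec; lra)))
  (fun y hy => @derivable_continuous_pt phi y (ex_derive_Reals_0 _ _ (ex_intro _ _ (dphi y
     (ltac:(move: hy; rewrite /Rmin /Rmax; case: Rle_dec; lra)))))).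
have {}hc : 0 <= c <= x by move: hc; rewrite /Rmin /Rmax; case: Rle_dec; lra.
rewrite phi0 in e.
have -> : phi x = c ^ M / (1 - c) * (x - 0) by lra.
apply: Rmult_le_pos; last by lra.
by apply: Rdiv_le_0_compat; [apply: pow_le; lra | lra].
Qed.

(** Discrete comparison with the integral of [u^(-1-s)]: [n^(-s) - (n+1)^(-s) <= s n^(-1-s)], and
    the left side telescopes. *)
Lemma zeta_partial_lb (s : R) (Y : nat) : 0 < s ->
  (1 - exp (- s * ln (INR Y.+1))) / s
  <= \sum_(1 <= n < Y.+1) (/ INR n * exp (- s * ln (INR n))).
Proof.
move=> s0; apply/Rle_div_l => //; rewrite [X in _ <= X]Rmult_comm rsum_scal.
have e : 1 - exp (- s * ln (INR Y.+1)) =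
   \sum_(1 <= n < Y.+1) ((- exp (- s * ln (INR n.+1))) - - exp (- s * ln (INR n))).
  rewrite (rsum_telescope 1 Y.+1 (fun n => - exp (- s * ln (INR n)))) //=.
  by rewrite ln_1 Rmult_0_r exp_0; lra.
rewrite e; apply: rsum_le => n /andP[n0 _] _.
have h := ln_succ_ub n n0.
have -> : - s * ln (INR n.+1) = - s * (ln (INR n.+1) - ln (INR n)) + - s * ln (INR n) by lra.
rewrite exp_plus; set E := exp (- s * ln (INR n)).
have hE : 0 < E by exact: exp_pos.
have := exp_ineq1_le (- s * (ln (INR n.+1) - ln (INR n))) => h2.
have h3 : 1 - s * / INR n <= exp (- s * (ln (INR n.+1) - ln (INR n))) by nra.
by nra.
Qed.

(** With [y = 1/p] and [t = p^(-s)] this bounds the Euler factor at [1 + s] by the summand of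
    [ln_mertens] weighted by [p^(-s)]. *)
Lemma ln_bernoulli (y t : R) : 0 <= y < 1 -> 0 < t <= 1 ->
  - ln (1 - y * t) <= t * - ln (1 - y).
Proof.
move=> hy ht.
have hp : 0 < 1 - y by lra.
have hpt : 0 < 1 - y * t by nra.
(* [1 - y t = t (1 - y) + (1 - t) 1]; concavity of [ln] through its tangent there. *)
have h1 := ln_le_sub1 ((1 - y) / (1 - y * t)) ltac:(apply: Rdiv_lt_0_compat; lra).
have h2 := ln_le_sub1 (1 / (1 - y * t)) ltac:(apply: Rdiv_lt_0_compat; lra).
rewrite !ln_div ?ln_1 in h1 h2; try lra.
have e : t * ((1 - y) / (1 - y * t) - 1) + (1 - t) * (1 / (1 - y * t) - 1) = 0.
  by field; lra.
have := Rmult_le_compat_l t _ _ ltac:(lra) h1.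
have := Rmult_le_compat_l (1 - t) _ _ ltac:(lra) h2.
lra.
Qed.

Lemma ln_mertens_mono (m n : nat) : (m <= n)%N -> ln_mertens m <= ln_mertens n.
Proof.
move=> h; apply: rsum_widen => [|p _ pp]; first by lia.
have p2 := INR_dvdn_prime p pp.
have hi : 0 < / INR p by apply: Rinv_0_lt_compat; lra.
have hi2 : / INR p <= / 2 by apply: Rinv_le_contravar; lra.
by have := ln_le_sub1 (1 - / INR p) ltac:(lra); lra.
Qed.

(* Primes in [(2^(m-1), 2^m]] have [p^(-s) <= r^(m-1)] when [r = 2^(-s)]. *)
Lemma prime_zeta_dyadic (s r : R) (M : nat) : 0 < s -> r = exp (- s * ln 2) ->
  \sum_(0 <= p < (expn 2 M).+1 | prime p)
     (- ln (1 - / INR p) * exp (- s * ln (INR p)))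
  <= \sum_(1 <= m < M.+1) ((ln_mertens (expn 2 m) - ln_mertens (expn 2 m.-1)) * r ^ m.-1).
Proof.
move=> s0 hr; elim: M => [|M IH].
  rewrite expn0 [X in _ <= X]big_geq // big_nat_cond big1; first by lra.
  by move=> p /andP[/andP[_ h] /prime_gt1]; lia.
have hM : (expn 2 M < expn 2 M.+1)%N by rewrite ltn_exp2l.
rewrite (@big_cat_nat _ _ _ (expn 2 M).+1) //= ?ltnS ?(ltnW hM) //.
rewrite [X in _ <= X]rsum_recr //=.
apply: Rplus_le_compat => //.
have -> : ln_mertens (expn 2 M.+1) - ln_mertens (expn 2 M)
   = \sum_((expn 2 M).+1 <= p < (expn 2 M.+1).+1 | prime p) - ln (1 - / INR p).
  rewrite {1}/ln_mertens (@big_cat_nat _ _ _ (expn 2 M).+1) //= ?ltnS ?(ltnW hM) //.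
  by rewrite /ln_mertens; lra.
rewrite Rmult_comm rsum_scal; apply: rsum_le => p /andP[hp _] pp.
rewrite Rmult_comm; apply: Rmult_le_compat_r.
  have p2 := INR_dvdn_prime p pp.
  have hi : 0 < / INR p by apply: Rinv_0_lt_compat; lra.
  have hi2 : / INR p <= / 2 by apply: Rinv_le_contravar; lra.
  by have := ln_le_sub1 (1 - / INR p) ltac:(lra); lra.
have -> : r ^ M = exp (- s * ln (INR (expn 2 M))).
  rewrite INR_expn ln_pow_nat; last by rewrite /=; lra.
  have -> : INR 2 = 2 by [].
  rewrite hr; elim: (M) => [|k IHk]; first by rewrite /= Rmult_0_l Rmult_0_r exp_0.
  by rewrite [_ ^ _]/= IHk -exp_plus S_INR; congr exp; lra.
apply: exp_le.
have h : ln (INR (expn 2 M)) <= ln (INR p).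
  apply: ln_le; first by apply: INR_gt0; rewrite expn_gt0.
  by apply: INR_leq; lia.
nra.
Qed.

(** The Euler product of [zeta(1 + s)] over [p <= Y] dominates the partial sum up to [Y], since all
    [n <= Y] are smooth; [ln_bernoulli] then treats each factor. *)
Lemma ln_prime_zeta_lb (s : R) (Y : nat) : 0 < s -> (0 < Y)%N ->
  ln ((1 - exp (- s * ln (INR Y.+1))) / s)
  <= \sum_(0 <= p < Y.+1 | prime p) (- ln (1 - / INR p) * exp (- s * ln (INR p))).
Proof.
move=> s0 Y0; pose f n := if n is 0%N then 0 else / INR n * exp (- s * ln (INR n)).
have fE n : (0 < n)%N -> f n = / INR n * exp (- s * ln (INR n)) by case: n.
have f0 n : 0 <= f n.
  case: n => [|n]; first by rewrite /=; lra.
  rewrite fE //; apply: Rmult_le_pos; last by apply/Rlt_le/exp_pos.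
  by apply/Rlt_le/Rinv_0_lt_compat/INR_gt0.
have le1 n : (0 < n)%N -> exp (- s * ln (INR n)) <= 1.
  by move=> n0; rewrite -exp_0; apply: exp_le; have := ln_INR_ge0 n; nra.
have fm : prime_mult f.
  move=> p m pp m0; have p0 := prime_gt0 pp.
  rewrite !fE ?muln_gt0 ?p0 // INR_muln ln_mult; [|exact: INR_gt0|exact: INR_gt0].
  rewrite Rmult_plus_distr_l exp_plus Rinv_mult; lra.
have f1 : f 1%N = 1 by rewrite /= ln_1 Rmult_0_r exp_0 Rinv_1; lra.
have hip p : prime p -> 0 < / INR p <= / 2.
  move=> pp; have p2 := INR_dvdn_prime p pp.
  split; first by apply: Rinv_0_lt_compat; lra.
  by apply: Rinv_le_contravar; lra.
have flt p : prime p -> f p < 1.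
  move=> pp; rewrite fE ?prime_gt0 //; have := hip p pp.
  by have := le1 p (prime_gt0 pp); have := exp_pos (- s * ln (INR p)); nra.
have h1 := zeta_partial_lb s Y s0.
have h2 := smooth_sum_ub f Y.+1 Y fm f0 f1 flt Y0.
have h3 : (1 - exp (- s * ln (INR Y.+1))) / s <= exp (ln_euler f Y.+1).
  apply: Rle_trans h1 (Rle_trans _ _ _ _ h2).
  rewrite smooth_sum_full; apply: rsum_le => n /andP[n0 _] _; rewrite fE //; lra.
have hpos : 0 < (1 - exp (- s * ln (INR Y.+1))) / s.
  apply: Rdiv_lt_0_compat => //.
  suff : exp (- s * ln (INR Y.+1)) < 1 by lra.
  rewrite -exp_0; apply: exp_increasing.
  have : 0 < ln (INR Y.+1).
    by rewrite -ln_1; apply: ln_increasing; [lra | apply: (INR_ltn 1)].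
  nra.
apply: Rle_trans (ln_le _ _ hpos h3) _; rewrite ln_exp.
apply: rsum_le => p _ pp; rewrite fE ?prime_gt0 //.
have hi := hip p pp.
by have := ln_bernoulli (/ INR p) (exp (- s * ln (INR p))) ltac:(lra)
  (conj (exp_pos _) (le1 p (prime_gt0 pp))); lra.
Qed.

(** Abel summation transfers an upper bound for [G] to the weighted sum. The slack [D] allowed below
    [m0] costs only [D m0 (1 - r)], which vanishes as [r -> 1]. *)
Lemma abel_harmonic_bound (G : nat -> R) (beta D r : R) (m0 M : nat) :
  0 <= r <= 1 -> G 0%N = 0 -> 0 <= D ->
  (forall m, (0 < m)%N -> G m <= harmonic m + beta + (if (m < m0)%N then D else 0)) ->
  (0 < m0 <= M)%N ->
  \sum_(1 <= m < M.+1) ((G m - G m.-1) * r ^ m.-1)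
  <= \sum_(1 <= m < M.+1) (r ^ m.-1 / INR m) + beta + D * INR m0 * (1 - r).
Proof.
move=> hr G0 D0 hG /andP[m00 hM].
have rM k : 0 <= r ^ k <= 1.
  by split; [apply: pow_le; lra | rewrite -(pow1 k); apply: pow_incr].
(* With the boundary terms subtracted, the step from [k] to [k + 1] is the hypothesis at [k + 1]
   times [r^k (1 - r)]; [minn] counts the steps that pay for [D]. *)
have claim : \sum_(1 <= m < M.+1) ((G m - G m.-1) * r ^ m.-1) - G M * r ^ M
  <= \sum_(1 <= m < M.+1) (r ^ m.-1 / INR m) - harmonic M * r ^ M
     + beta * (1 - r ^ M) + D * INR (minn M m0) * (1 - r).
  elim: (M) => [|k IH].
    by rewrite !big_geq // min0n G0 /harmonic big_geq //= ; lra.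
  rewrite rsum_recr // (rsum_recr 1 k.+1 _ (fun m => r ^ m.-1 / INR m)) //=.
  rewrite -/(INR k.+1) harmonicS.
  have hk := hG k.+1 isT; rewrite harmonicS in hk.
  have rk := rM k.
  have hmin : INR (minn k.+1 m0) = INR (minn k m0) + (if (k < m0)%N then 1 else 0).
    case: ltnP => h; last by rewrite !(minn_idPr _) ?Rplus_0_r //; lia.
    by rewrite !(minn_idPl _) ?S_INR //; lia.
  have hd : (if (k.+1 < m0)%N then D else 0) * (r ^ k * (1 - r))
     <= D * (if (k < m0)%N then 1 else 0) * (1 - r).
    case: (ltnP k.+1 m0) => h; last first.
      by case: ifP => _; rewrite ?Rmult_0_l; [nra | lra].
    have -> : (k < m0)%N by lia.
    by have : 0 <= D * (1 - r) * (1 - r ^ k); [apply: Rmult_le_pos; nra | lra].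
  rewrite hmin /Rdiv.
  have := Rmult_le_compat_r (r ^ k * (1 - r)) _ _ ltac:(apply: Rmult_le_pos; lra) hk.
  lra.
have := hG M (leq_trans m00 hM); rewrite ltnNge hM /= Rplus_0_r => hGM.
move: claim; rewrite (minn_idPr hM).
have := Rmult_le_compat_r (r ^ M) _ _ (proj1 (rM M)) hGM; lra.
Qed.

(** Two estimates of the same sum over primes: from below by the logarithm of a truncated
    [zeta(1 + sg)], from above by dyadic partial summation. The main terms [- ln u] and [ln (ln 2)]
    cancel, leaving [b - euler_gamma] up to [O(s)]. *)
Lemma ln_mertens_lb_approx (x : nat) (b : R) : (2 <= x)%N ->
  (forall y, (x <= y)%N -> ln_mertens y <= ln (ln (INR y)) + b) ->
  exists C, forall s, 0 < s <= 1/2 -> - C * s <= b - euler_gamma.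
Proof.
move=> hx hb.
have [_ hgam] := euler_gamma_spec.
pose beta := b - euler_gamma + ln (ln 2).
pose G m := ln_mertens (expn 2 m).
(* Covers the indices [m < x], where the hypothesis may not apply but [G m <= G x]. *)
pose D := Rabs (G x) + Rabs beta.
have ln2p : 0 < ln 2 by have := ln2_ge_half; lra.
have D0 : 0 <= D by have := Rabs_pos (G x); have := Rabs_pos beta; rewrite /D; lra.
have G0 : G 0%N = 0.
  rewrite /G /ln_mertens expn0 big_nat_cond big1 //.
  by move=> p /andP[/andP[_ h] /prime_gt1]; lia.
have hG m : (0 < m)%N -> G m <= harmonic m + beta + (if (m < x)%N then D else 0).
  move=> m0; case: ltnP => h.
    have h1 : G m <= G x by apply: ln_mertens_mono; rewrite leq_exp2l // ltnW.
    have h2 : 0 <= harmonic m.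
      apply: rsum_ge0 => i /andP[i0 _] _.
      by apply/Rlt_le/Rinv_0_lt_compat/INR_gt0.
    have := Rle_abs (G x); have := Rle_abs (- beta); rewrite Rabs_Ropp /D; lra.
  have := hb (expn 2 m) ltac:(by apply: leq_trans h _; apply/ltnW/ltn_expl).
  rewrite -/(G m) INR_expn ln_pow_nat; last by rewrite /=; lra.
  have -> : INR 2 = 2 by [].
  rewrite ln_mult //; last exact: INR_gt0.
  by have := hgam m m0; rewrite /beta; lra.
(* One 4 pays for [2 ln r >= - 4 u], the other for [(u/r) (- ln u) <= 4 s]. *)
exists (8 + D * INR x) => s hs.
(* Squaring makes the error [u (- ln u)] of size [O(s)], through the crude bound [- ln u <= 2/s]. *)
pose u := s * s; pose r := 1 - u.
have hu : 0 < u <= 1/4 by rewrite /u; nra.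
have us : u <= s by rewrite /u; nra.
have r0 : 3/4 <= r < 1 by rewrite /r; lra.
pose sg := - ln r / ln 2.
have lnr : ln r < 0 by rewrite -ln_1; apply: ln_increasing; lra.
have lnr2 : - ln r <= u / r.
  have := ln_ge_1_inv r ltac:(lra).
  have -> : u / r = / r - 1 by rewrite /r; field; rewrite /r in r0; lra.
  lra.
have sg0 : 0 < sg by apply: Rdiv_lt_0_compat; lra.
have hr : r = exp (- sg * ln 2).
  have -> : - sg * ln 2 = ln r by rewrite /sg; field; lra.
  by rewrite exp_ln; lra.
(* [M] is so large that truncating zeta at [2^M] costs at most a factor [1 - u = r]. *)
have [M0 hM0] := pow_lt_1_zero r ltac:(rewrite Rabs_right; lra) u ltac:(lra).
pose M := (M0 + x)%N.
have rMu : r ^ M <= u.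
  have := hM0 M ltac:(rewrite /M; lia); rewrite Rabs_right; first by lra.
  by apply: Rle_ge; apply: pow_le; lra.
have h1 := ln_prime_zeta_lb sg (expn 2 M) sg0 ltac:(by rewrite expn_gt0).
have h2 := prime_zeta_dyadic sg r M sg0 hr.
have h3 := abel_harmonic_bound G beta D r x M ltac:(lra) G0 D0 hG
   ltac:(rewrite /M; lia).
have h4 : \sum_(1 <= m < M.+1) (r ^ m.-1 / INR m) <= / r * - ln u.
  have := sum_pow_div_le r M ltac:(lra).
  have -> : 1 - r = u by rewrite /r; lra.
  move=> h; apply: Rle_trans (Rmult_le_compat_l (/ r) _ _ _ h); last first.
    by apply/Rlt_le/Rinv_0_lt_compat; lra.
  rewrite rsum_scal; apply: Req_le; apply: eq_big_nat => -[|m] // _.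
  by rewrite [m.+1.-1]/= [r ^ m.+1]/= /Rdiv; move: (/ INR m.+1) => c; field; lra.
have hE : exp (- sg * ln (INR (expn 2 M).+1)) <= u.
  apply: Rle_trans rMu.
  have -> : r ^ M = exp (INR M * ln r).
    by rewrite -ln_pow_nat ?exp_ln //; [apply: pow_lt; lra | lra].
  apply: exp_le.
  have h : INR M * ln 2 <= ln (INR (expn 2 M).+1).
    have -> : 2 = INR 2 by [].
    rewrite -ln_pow_nat -?INR_expn; last by rewrite /=; lra.
    by apply: ln_le; [apply: INR_gt0; rewrite expn_gt0 | apply: INR_leq].
  have := Rmult_le_compat_l sg _ _ (Rlt_le _ _ sg0) h.
  have -> : sg * (INR M * ln 2) = - (INR M * ln r) by rewrite /sg; field; lra.
  lra.
have h5 : r * (ln 2 * (r / u)) <= (1 - exp (- sg * ln (INR (expn 2 M).+1))) / sg.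
  apply: Rmult_le_compat; try lra.
  - by apply: Rmult_le_pos; [lra | apply: Rdiv_le_0_compat; lra].
  - by rewrite /r; lra.
  have -> : ln 2 * (r / u) = / (u / r / ln 2) by field; lra.
  apply: Rinv_le_contravar => //; rewrite /sg; apply: Rmult_le_compat_r => //.
  by apply/Rlt_le/Rinv_0_lt_compat.
have h6 : 2 * ln r + ln (ln 2) - ln u
    <= ln ((1 - exp (- sg * ln (INR (expn 2 M).+1))) / sg).
  have hp : 0 < r / u by apply: Rdiv_lt_0_compat; lra.
  have hp2 : 0 < ln 2 * (r / u) by apply: Rmult_lt_0_compat; lra.
  apply: Rle_trans (ln_le _ _ _ h5); last by apply: Rmult_lt_0_compat; lra.
  have hr0 : 0 < r by lra.
  have hu0 : 0 < u by lra.
  rewrite (ln_mult r) // (ln_mult (ln 2)) // (ln_div r) //; lra.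
have lnu : - ln u <= 2 / s.
  rewrite /u ln_mult; try lra.
  have := ln_ge_1_inv s ltac:(lra); rewrite /Rdiv; lra.
have h7 : u / r * - ln u <= 4 * s.
  have -> : 4 * s = (u * 2) * (2 / s) by rewrite /u; field; lra.
  apply: Rmult_le_compat => //.
  - by apply: Rdiv_le_0_compat; lra.
  - by have := ln_le_sub1 u ltac:(lra); lra.
  apply: Rmult_le_compat_l; first by lra.
  by rewrite -(Rinv_inv 2); apply: Rinv_le_contravar; lra.
have h8 : u / r <= 2 * u.
  rewrite Rmult_comm; apply: Rmult_le_compat_l; first by lra.
  by rewrite -[X in _ <= X](Rinv_inv 2); apply: Rinv_le_contravar; lra.
have h9 : / r * - ln u = - ln u + u / r * - ln u by rewrite /r; field; rewrite /r in r0; lra.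
have h10 : D * INR x * (1 - r) <= D * INR x * s.
  apply: Rmult_le_compat_l; last by rewrite /r; lra.
  by apply: Rmult_le_pos => //; exact: pos_INR.
rewrite -/(G _) in h2; rewrite /beta in h3.
have h2' := Rle_trans _ _ _ h2 h3.
lra.
Qed.

(** [ln_mertens_ub] supplies the hypothesis of [ln_mertens_lb_approx] with this [b], and letting
    [s -> 0] there gives [b >= euler_gamma]. *)
Lemma ln_mertens_lb (x : nat) : (2 <= x)%N ->
  euler_gamma + ln (ln (INR x)) - 6 / ln (INR x) <= ln_mertens x.
Proof.
move=> hx; pose b := ln_mertens x - ln (ln (INR x)) + 6 / ln (INR x).
have [y hy|C hC] := ln_mertens_lb_approx x b hx.
  by have := ln_mertens_ub x y; rewrite hx hy => /(_ isT); rewrite /b; lra.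
suff : 0 <= b - euler_gamma by rewrite /b; lra.
apply: Rnot_lt_le => hneg.
(* Chosen so that [s = (euler_gamma - b) / (2 C1)] is at most 1/2 while [C s] is at most half the
   supposed gap. *)
pose C1 := Rabs C + 1 + (euler_gamma - b).
have hC1 : 0 < C1 by rewrite /C1; have := Rabs_pos C; lra.
pose s := (euler_gamma - b) / (2 * C1).
have hs : 0 < s <= 1/2.
  split; first by apply: Rdiv_lt_0_compat; lra.
  apply/Rle_div_l; first by lra.
  by rewrite /C1; have := Rabs_pos C; lra.
have h1 := hC s hs.
have h2 : C * s <= C1 * s.
  by apply: Rmult_le_compat_r; [lra | rewrite /C1; have := Rle_abs C; lra].
have h3 : C1 * s = (euler_gamma - b) / 2 by rewrite /s; field; lra.
lra.
Qed.

(** * Sums over primes for the resonator *)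

Lemma sum_ln_ratio_step (P : pred nat) (F : nat -> R) (Z : nat) : (0 < Z)%N ->
  \sum_(1 <= n < Z.+2 | P n) (F n * ln (INR Z.+1 / INR n))
  = \sum_(1 <= n < Z.+1 | P n) (F n * ln (INR Z / INR n))
    + (ln (INR Z.+1) - ln (INR Z)) * \sum_(1 <= n < Z.+1 | P n) F n.
Proof.
move=> Z0; rewrite rsum_recr //.
have -> : (if P Z.+1 then F Z.+1 * ln (INR Z.+1 / INR Z.+1) else 0) = 0.
  rewrite /Rdiv Rinv_r ?ln_1; first by case: ifP => _; lra.
  exact: not_0_INR.
rewrite Rplus_0_r rsum_scal -rsum_split.
rewrite big_nat_cond [RHS]big_nat_cond; apply: eq_bigr => n /andP[/andP[n0 _] _].
rewrite !ln_div; [lra|exact: INR_gt0|exact: INR_gt0|exact: INR_gt0|exact: INR_gt0].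
Qed.

Lemma ln_ratio_ge0 (n Z : nat) : (0 < n <= Z)%N -> 0 <= ln (INR Z / INR n).
Proof.
move=> /andP[n0 nZ]; apply: ln_ge0; have h := INR_gt0 n n0.
by apply/Rle_div_r; have := INR_leq n Z nZ; lra.
Qed.

Lemma sum_ln_ratio (Z : nat) : (0 < Z)%N ->
  \sum_(1 <= n < Z.+1) (1 * ln (INR Z / INR n)) <= INR Z.
Proof.
elim: Z => // Z IH _; case: Z IH => [|Z] IH.
  by rewrite big_nat1 /= /Rdiv Rinv_1 Rmult_1_r ln_1; lra.
rewrite sum_ln_ratio_step //; have hS := S_INR Z.+1.
have := IH isT; have := ln_succ_ub Z.+1 isT; have hZ := INR_gt0 Z.+1 isT.
have -> : \sum_(1 <= n < Z.+2) 1 = INR Z.+1 by rewrite rsum_const // (S_INR Z.+1) /=; lra.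
move=> h1 h2.
have : (ln (INR Z.+2) - ln (INR Z.+1)) * INR Z.+1 <= 1.
  by have := Rmult_le_compat_r _ _ _ (Rlt_le _ _ hZ) h1; rewrite Rinv_l; lra.
lra.
Qed.

(** Passing from [Z] to [Z + 1] shifts every logarithm by [dl <= 1/Z]; the cross term adds at most 2
    and [dl^2 Z] at most 1. *)
Lemma sum_ln_ratio_sqr (Z : nat) : (0 < Z)%N ->
  \sum_(1 <= n < Z.+1) (ln (INR Z / INR n) * ln (INR Z / INR n)) <= 3 * INR Z.
Proof.
elim: Z => // Z IH _; case: Z IH => [|Z] IH.
  by rewrite big_nat1 /= /Rdiv Rinv_1 Rmult_1_r ln_1; lra.
have hZ := INR_gt0 Z.+1 isT.
set dl := ln (INR Z.+2) - ln (INR Z.+1).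
have h1 : dl <= / INR Z.+1 := ln_succ_ub Z.+1 isT.
have h0 : 0 <= dl.
  have := ln_succ_lb Z.+1 isT; rewrite -/dl.
  by have := Rinv_0_lt_compat _ (INR_gt0 Z.+2 isT); lra.
have e : \sum_(1 <= n < Z.+3) (ln (INR Z.+2 / INR n) * ln (INR Z.+2 / INR n))
   = \sum_(1 <= n < Z.+2) (ln (INR Z.+1 / INR n) * ln (INR Z.+1 / INR n))
     + (2 * dl * \sum_(1 <= n < Z.+2) (1 * ln (INR Z.+1 / INR n)) + dl * dl * INR Z.+1).
  rewrite rsum_nat_recr //.
  have -> : ln (INR Z.+2 / INR Z.+2) = 0.
    by rewrite /Rdiv Rinv_r ?ln_1 //; apply: not_0_INR.
  rewrite Rmult_0_l Rplus_0_r.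
  have -> : dl * dl * INR Z.+1 = \sum_(1 <= n < Z.+2) (dl * dl).
    by rewrite rsum_const // (S_INR Z.+1) [INR 1]/=; lra.
  rewrite rsum_scal -rsum_split -rsum_split; apply: eq_big_nat => n /andP[n0 _].
  rewrite !ln_div; try exact: INR_gt0.
  by rewrite /dl; lra.
rewrite e; have hS := S_INR Z.+1.
have := IH isT; have h2 := sum_ln_ratio Z.+1 isT.
have h3 : dl * INR Z.+1 <= 1.
  by have := Rmult_le_compat_r _ _ _ (Rlt_le _ _ hZ) h1; rewrite Rinv_l; lra.
have h4 : dl * \sum_(1 <= n < Z.+2) (1 * ln (INR Z.+1 / INR n)) <= dl * INR Z.+1.
  exact: Rmult_le_compat_l.
have h5 : dl <= 1.
  apply: Rle_trans h1 _; rewrite -Rinv_1; apply: Rinv_le_contravar; first lra.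
  exact: INR_ge1.
nra.
Qed.

Lemma theta_from1 (Z : nat) : \sum_(1 <= p < Z.+1 | prime p) ln (INR p) = theta Z.
Proof. by rewrite /theta [in RHS]big_mkcond big_ltn //= -big_mkcond Rplus_0_l. Qed.

Lemma sum_lnp_ln_ratio (Z : nat) : (0 < Z)%N ->
  \sum_(1 <= p < Z.+1 | prime p) (ln (INR p) * ln (INR Z / INR p)) <= 2 * INR Z.
Proof.
elim: Z => // Z IH _; case: Z IH => [|Z] IH.
  by rewrite big_mkcond big_nat1 /=; lra.
rewrite sum_ln_ratio_step // theta_from1; have hS := S_INR Z.+1.
have := IH isT; have hZ := INR_gt0 Z.+1 isT.
have h0 := ln_succ_ub Z.+1 isT.
have h1 : 0 <= ln (INR Z.+2) - ln (INR Z.+1).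
  have := ln_succ_lb Z.+1 isT.
  by have := Rinv_0_lt_compat _ (INR_gt0 Z.+2 isT); lra.
have h2 : theta Z.+1 <= INR Z.+1 * 2.
  apply: Rle_trans (theta_le _) _; apply: Rmult_le_compat_l; first lra.
  exact: ln4_le2.
have h3 : (ln (INR Z.+2) - ln (INR Z.+1)) * INR Z.+1 <= 1.
  by have := Rmult_le_compat_r _ _ _ (Rlt_le _ _ hZ) h0; rewrite Rinv_l; lra.
have := Rmult_le_compat_l _ _ _ h1 h2; lra.
Qed.

(* For [p <= Z] one has [1 = (ln p + ln (Z/p)) / ln Z]; multiplying the summand by this
   trades the count of primes for a sum over primes weighted by [ln p] plus a sum over
   all integers. *)
Lemma prime_sum_ln_split (Z : nat) (F : nat -> R) : (0 < Z)%N ->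
  ln (INR Z) * \sum_(1 <= p < Z.+1 | prime p) F p
  = \sum_(1 <= p < Z.+1 | prime p) (ln (INR p) * F p)
    + \sum_(1 <= p < Z.+1 | prime p) (ln (INR Z / INR p) * F p).
Proof.
move=> Z0; rewrite -rsum_split rsum_scal big_nat_cond [RHS]big_nat_cond.
apply: eq_bigr => p /andP[/andP[p0 _] _].
rewrite ln_div; [lra | exact: INR_gt0 | exact: INR_gt0].
Qed.

Lemma prime_count_le (Z : nat) : (0 < Z)%N ->
  ln (INR Z) * \sum_(1 <= p < Z.+1 | prime p) 1 <= 3 * INR Z.
Proof.
move=> Z0; rewrite prime_sum_ln_split //.
have -> : \sum_(1 <= p < Z.+1 | prime p) (ln (INR p) * 1) = theta Z.
  by rewrite -theta_from1; apply: eq_bigr => p _; lra.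
have h1 : theta Z <= INR Z * 2.
  apply: Rle_trans (theta_le _) _; apply: Rmult_le_compat_l; first exact: pos_INR.
  exact: ln4_le2.
have h2 := sum_ln_ratio Z Z0.
suff : \sum_(1 <= p < Z.+1 | prime p) (ln (INR Z / INR p) * 1)
   <= \sum_(1 <= n < Z.+1) (1 * ln (INR Z / INR n)) by lra.
apply: Rle_trans (rsum_cond_le 1 Z.+1 prime _ _) _.
  by move=> i hi; rewrite Rmult_1_r; apply: ln_ratio_ge0.
by apply: rsum_le => i _ _; lra.
Qed.

(** The saved factor [ln Z] is what allows [Z] of size [log N loglog N]; [5 = 2 + 3] comes from the
    two sums of the splitting. *)
Lemma prime_sum_ln_ratio_le (Z : nat) : (0 < Z)%N ->
  ln (INR Z) * \sum_(1 <= p < Z.+1 | prime p) ln (INR Z / INR p) <= 5 * INR Z.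
Proof.
move=> Z0; rewrite prime_sum_ln_split //.
have h1 := sum_lnp_ln_ratio Z Z0; have h2 := sum_ln_ratio_sqr Z Z0.
have h3 := rsum_cond_le 1 Z.+1 prime
  (fun n => ln (INR Z / INR n) * ln (INR Z / INR n)) (fun i hi => Rle_0_sqr _).
lra.
Qed.

(** * Resonator coefficients and their Dirichlet sum *)

Definition res_p (Z p : nat) : R := 1 - INR p / INR Z.

(** Primes above [Z] are ignored by the product, so [res_q] is always used together with the test
    [smooth Z.+1]. *)
Definition res_q (Z k : nat) : R :=
  \big[Rmult/1]_(0 <= p < Z.+1 | prime p) res_p Z p ^ logn p k.

Lemma res_p_range (Z p : nat) : (0 < p <= Z)%N -> 0 <= res_p Z p < 1.
Proof.
move=> /andP[p0 pZ]; have hp := INR_gt0 p p0; have hZ := INR_leq p Z pZ.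
have : 0 < INR p / INR Z by apply: Rdiv_lt_0_compat; lra.
have : INR p / INR Z <= 1 by apply/Rle_div_l; lra.
by rewrite /res_p; lra.
Qed.

Lemma res_q_range (Z k : nat) : 0 <= res_q Z k <= 1.
Proof.
rewrite /res_q big_nat_cond; apply: (big_ind (fun x => 0 <= x <= 1)); first lra.
  by move=> x y; nra.
move=> p /andP[/andP[_ hp] pp].
have := res_p_range Z p; rewrite prime_gt0 // -ltnS hp => /(_ isT) h.
split; first by apply: pow_le; lra.
by rewrite -(pow1 (logn p k)); apply: pow_incr; lra.
Qed.

Lemma res_qM (Z m n : nat) : (0 < m)%N -> (0 < n)%N ->
  res_q Z (m * n) = res_q Z m * res_q Z n.
Proof.
move=> m0 n0; rewrite /res_q -big_split /=; apply: eq_bigr => p _.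
by rewrite lognM // Rdef_pow_add.
Qed.

Lemma res_q1 (Z : nat) : res_q Z 1 = 1.
Proof. by rewrite /res_q big1 // => p _; rewrite logn1. Qed.

Lemma res_q_prime (Z p : nat) : prime p -> (p <= Z)%N -> res_q Z p = res_p Z p.
Proof.
move=> pp pZ; rewrite /res_q big_mkcond (bigD1_seq p) ?iota_uniq //=; last first.
  by rewrite mem_index_iota ltnS pZ.
rewrite pp (logn_prime p pp) eqxx big1 ?Rmult_1_r ?pow_1 // => r hr.
by case: ifP => // pr; rewrite logn_prime // (negbTE hr).
Qed.

Definition res_f (Z k : nat) : R := res_q Z k / INR k.

(** The loss [13 = 6 + 6 + 1], each over [ln Z] in the exponent, comes from Mertens' theorem, from
    replacing [1/p] by [q_p/p], and from cutting exponents at [2 (Z + 1)], where [f(p) <= 1/2] makes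
    the tail at most [d = (Z + 1)^(-2)]. *)
Lemma res_sum_lb (Z X : nat) : (2 <= Z)%N ->
  (expn Z.+1 (Z.+1 * (2 * Z.+1)) <= X)%N ->
  exp euler_gamma * (ln (INR Z) - 13) <= smooth_sum (res_f Z) Z.+1 X.
Proof.
move=> Z2 hX.
have hZ := INR_ge2 Z Z2.
have f0 k : 0 <= res_f Z k.
  case: k => [|k]; first by rewrite /res_f /Rdiv Rinv_0 Rmult_0_r; lra.
  apply: Rdiv_le_0_compat; last exact: INR_gt0.
  by have := res_q_range Z k.+1; lra.
have f1 : res_f Z 1 = 1 by rewrite /res_f res_q1 /=; lra.
have fm : prime_mult (res_f Z).
  move=> p m pp m0; have p0 := prime_gt0 pp.
  by rewrite /res_f res_qM // INR_muln /Rdiv Rinv_mult; lra.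
have fp p : prime p -> res_f Z p <= / 2.
  move=> pp; have p2 := INR_dvdn_prime p pp; have := res_q_range Z p.
  have : / INR p <= / 2 by apply: Rinv_le_contravar; lra.
  have : 0 < / INR p by apply: Rinv_0_lt_compat; lra.
  by rewrite /res_f /Rdiv; nra.
pose w := INR Z.+1; have hw : w = INR Z + 1 by rewrite /w S_INR.
pose d := / (w * w).
have hd : 0 < d < 1.
  split; first by apply: Rinv_0_lt_compat; nra.
  by rewrite -Rinv_1; apply: Rinv_lt_contravar; nra.
have hE p : prime p -> res_f Z p ^ (2 * Z.+1) <= d.
  move=> pp; apply: Rle_trans (_ : (/ 2) ^ (2 * Z.+1) <= _).
    by apply: pow_incr; split; [exact: f0 | exact: fp].
  rewrite pow_inv /d mul2n -addnn Rdef_pow_add.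
  have h : w <= 2 ^ Z.+1.
    rewrite /w (_ : 2 = INR 2) // -INR_expn; apply: INR_leq.
    exact/ltnW/ltn_expl.
  by apply: Rinv_le_contravar; nra.
have half_lt1 : / 2 < 1 by lra.
have h1 := smooth_sum_lb (res_f Z) Z.+1 (2 * Z.+1) d fm f0 f1
  (fun p pp => Rle_lt_trans _ _ _ (fp p pp) half_lt1) hd hE.
have h2 := smooth_sum_mono (res_f Z) Z.+1 _ _ f0 hX.
apply: Rle_trans h2; apply: Rle_trans h1.
have lnZ : 0 < ln (INR Z) by rewrite -ln_1; apply: ln_increasing; lra.
have hiZ : / INR Z <= / ln (INR Z).
  by apply: Rinv_le_contravar => //; have := ln_le_sub1 (INR Z) ltac:(lra); lra.
have ha : - (1 / ln (INR Z)) <= w * ln (1 - d).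
  have h := ln_ge_1_inv (1 - d) ltac:(lra).
  have : - / INR Z <= w * (1 - / (1 - d)).
    have hw2 : 0 < w * w - 1 by nra.
    have -> : w * (1 - / (1 - d)) = - (w / (w * w - 1)).
      by rewrite /d; field; split; nra.
    apply: Ropp_le_contravar; apply/Rle_div_l => //.
    rewrite hw; apply: (Rmult_le_reg_l (INR Z)); first lra.
    by rewrite -Rmult_assoc Rinv_r; nra.
  have := Rmult_le_compat_l w _ _ ltac:(lra) h; lra.
have hb : ln_mertens Z - 6 / ln (INR Z) <= ln_euler (res_f Z) Z.+1.
  have hc := prime_count_le Z (ltnW Z2).
  have hc2 : 2 / INR Z * \sum_(1 <= p < Z.+1 | prime p) 1 <= 6 / ln (INR Z).
    apply: (Rmult_le_reg_l (ln (INR Z) * INR Z)); first by nra.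
    have -> : ln (INR Z) * INR Z * (6 / ln (INR Z)) = 6 * INR Z by field; lra.
    set S := bigop _ _ _ in hc *.
    have -> : ln (INR Z) * INR Z * (2 / INR Z * S) = 2 * (ln (INR Z) * S) by field; lra.
    lra.
  have e0 : \sum_(1 <= p < Z.+1 | prime p) 1 = \sum_(0 <= p < Z.+1 | prime p) 1.
    by rewrite [in RHS]big_mkcond big_ltn //= -big_mkcond Rplus_0_l.
  suff : ln_mertens Z - 2 / INR Z * \sum_(1 <= p < Z.+1 | prime p) 1
     <= ln_euler (res_f Z) Z.+1 by lra.
  rewrite e0 rsum_scal /ln_mertens -rsum_sub; apply: rsum_le => p hp pp.
  have p2 := INR_dvdn_prime p pp.
  have hip : / INR p <= / 2 by apply: Rinv_le_contravar; lra.
  have hip0 : 0 < / INR p by apply: Rinv_0_lt_compat; lra.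
  have hiz0 : 0 < / INR Z by apply: Rinv_0_lt_compat; lra.
  rewrite /res_f res_q_prime // /res_p.
  have -> : 1 - (1 - INR p / INR Z) / INR p = 1 - / INR p + / INR Z by field; lra.
  (* Since [1 - 1/p >= 1/2], each prime loses at most [2/Z], and [prime_count_le] bounds the number
     of primes. *)
  have hle : ln (1 - / INR p + / INR Z) <= ln ((1 - / INR p) * (1 + 2 / INR Z)).
    by apply: ln_le; rewrite /Rdiv; nra.
  have hl2 := ln_le_sub1 (1 + 2 / INR Z) ltac:(rewrite /Rdiv; lra).
  rewrite ln_mult in hle; [lra | lra | rewrite /Rdiv; lra].
have hc := ln_mertens_lb Z Z2.
have : euler_gamma + ln (ln (INR Z)) + - (13 / ln (INR Z))
   <= ln_euler (res_f Z) Z.+1 + w * ln (1 - d).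
  rewrite /Rdiv in ha hb hc *; lra.
move/exp_le; apply: Rle_trans.
rewrite exp_plus exp_plus exp_ln // Rmult_assoc.
apply: Rmult_le_compat_l; first exact/Rlt_le/exp_pos.
have -> : ln (INR Z) - 13 = ln (INR Z) * (1 + - (13 / ln (INR Z))) by field; lra.
by apply: Rmult_le_compat_l; [lra | exact: exp_ineq1_le].
Qed.

(** * The positive-definite cone *)

Definition cis (x : R) : C := (cos x, sin x).

Lemma cisD (x y : R) : cis (x + y) = Cmult (cis x) (cis y).
Proof. by rewrite /cis /Cmult /= cos_plus sin_plus; congr pair; lra. Qed.

Lemma cis0 : cis 0 = RtoC 1.
Proof. by rewrite /cis cos_0 sin_0. Qed.

Lemma Cmod_cis (x : R) : Cmod (cis x) = 1.
Proof.
rewrite /Cmod /cis /= !Rmult_1_r -[sqrt _]/(sqrt (Rsqr (cos x) + Rsqr (sin x))).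
by rewrite Rplus_comm sin2_cos2 sqrt_1.
Qed.

(* The Fejer-weighted Fourier coefficient at [th] of the Hermitian extension of [f] to
   [-L < l < L]. *)
Definition fejer (L : nat) (f : nat -> C) (th : R) : R :=
  INR L * Re (f 0%N)
  + 2 * \sum_(1 <= l < L) ((INR L - INR l) * Re (Cmult (f l) (cis (th * INR l)))).

Definition pos_def (L : nat) (f : nat -> C) : Prop := forall th, 0 <= fejer L f th.

Lemma eq_fejer (L : nat) (f g : nat -> C) (th : R) :
  (forall l, f l = g l) -> fejer L f th = fejer L g th.
Proof.
move=> e; rewrite /fejer e; congr (_ + 2 * _).
by apply: eq_bigr => l _; rewrite e.
Qed.

Lemma eq_pos_def (L : nat) (f g : nat -> C) :
  (forall l, f l = g l) -> pos_def L f -> pos_def L g.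
Proof. by move=> e H th; rewrite -(eq_fejer L f g th e). Qed.

Lemma fejerD (L : nat) (f g : nat -> C) (th : R) :
  fejer L (fun l => Cplus (f l) (g l)) th = fejer L f th + fejer L g th.
Proof.
rewrite /fejer.
rewrite (eq_bigr (fun l => (INR L - INR l) * Re (Cmult (f l) (cis (th * INR l)))
  + (INR L - INR l) * Re (Cmult (g l) (cis (th * INR l))))); last first.
  by move=> l _; rewrite /Re /Cmult /Cplus /=; lra.
by rewrite rsum_split /Re /Cplus /=; lra.
Qed.

Lemma fejerZ (L : nat) (c : R) (f : nat -> C) (th : R) :
  fejer L (fun l => Cmult (RtoC c) (f l)) th = c * fejer L f th.
Proof.
rewrite /fejer.
rewrite (eq_bigr (fun l => c * ((INR L - INR l) * Re (Cmult (f l) (cis (th * INR l)))))).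
  by rewrite -rsum_scal /Re /Cmult /=; lra.
by move=> l _; rewrite /Re /Cmult /=; lra.
Qed.

Lemma fejer_cis (L : nat) (a : R) (f : nat -> C) (th : R) :
  fejer L (fun l => Cmult (cis (a * INR l)) (f l)) th = fejer L f (th + a).
Proof.
rewrite /fejer [INR 0]/= Rmult_0_r cis0 Cmult_1_l; congr (_ + 2 * _).
apply: eq_bigr => l _; congr (_ * Re _).
by rewrite Rmult_plus_distr_r cisD; ring.
Qed.

(** The right side is the squared modulus of the sum of [cis (th j)] over [j < L]; increasing [L]
    adds the cosines of the differences with the new index. *)
Lemma fejer_kernel (L : nat) (th : R) :
  INR L + 2 * \sum_(1 <= l < L) ((INR L - INR l) * cos (th * INR l))
  = Rsqr (\sum_(0 <= j < L) cos (th * INR j)) + Rsqr (\sum_(0 <= j < L) sin (th * INR j)).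
Proof.
elim: L => [|L IH]; first by rewrite !big_geq //= /Rsqr; lra.
rewrite (rsum_nat_recr 0 L) // (rsum_nat_recr 0 L (fun j => sin _)) //.
set A := \sum_(0 <= j < L) cos _ in IH *; set B := \sum_(0 <= j < L) sin _ in IH *.
have e1 : \sum_(1 <= l < L.+1) ((INR L.+1 - INR l) * cos (th * INR l))
  = \sum_(1 <= l < L) ((INR L - INR l) * cos (th * INR l))
    + \sum_(1 <= l < L.+1) cos (th * INR l).
  case: L {IH A B} => [|L]; first by rewrite !big_geq //; lra.
  have -> : \sum_(1 <= l < L.+1) ((INR L.+1 - INR l) * cos (th * INR l))
    = \sum_(1 <= l < L.+2) ((INR L.+1 - INR l) * cos (th * INR l)).
    by rewrite [in RHS]rsum_nat_recr //; lra.
  by rewrite -rsum_split; apply: eq_bigr => l _; rewrite (S_INR L.+1); lra.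
have e2 : \sum_(1 <= l < L.+1) cos (th * INR l)
  = cos (th * INR L) * A + sin (th * INR L) * B.
  rewrite /A /B !rsum_scal -rsum_split big_add1 [_.-1]/= big_nat_rev add0n.
  apply: eq_big_nat => j /andP[_ hj]; rewrite -cos_minus; congr cos.
  have -> : (L - j.+1).+1 = (L - j)%N by lia.
  by rewrite minus_INR; [lra | lia].
rewrite e1 e2 S_INR.
have hcs := sin2_cos2 (th * INR L).
rewrite /Rsqr in IH hcs *; lra.
Qed.

Lemma pos_def1 (L : nat) : pos_def L (fun=> RtoC 1).
Proof.
move=> th; rewrite /fejer.
rewrite (eq_bigr (fun l => (INR L - INR l) * cos (th * INR l))); last first.
  by move=> l _; rewrite Cmult_1_l.
have := fejer_kernel L th; rewrite /Re /= => h.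
have h1 := Rle_0_sqr (\sum_(0 <= j < L) cos (th * INR j)).
have h2 := Rle_0_sqr (\sum_(0 <= j < L) sin (th * INR j)).
lra.
Qed.

Lemma pos_defD (L : nat) (f g : nat -> C) :
  pos_def L f -> pos_def L g -> pos_def L (fun l => Cplus (f l) (g l)).
Proof. by move=> hf hg th; rewrite fejerD; have := hf th; have := hg th; lra. Qed.

Lemma pos_defZ (L : nat) (c : R) (f : nat -> C) :
  0 <= c -> pos_def L f -> pos_def L (fun l => Cmult (RtoC c) (f l)).
Proof. by move=> hc hf th; rewrite fejerZ; apply: Rmult_le_pos. Qed.

Lemma pos_def_cis (L : nat) (a : R) (f : nat -> C) :
  pos_def L f -> pos_def L (fun l => Cmult (cis (a * INR l)) (f l)).
Proof. by move=> hf th; rewrite fejer_cis. Qed.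

(** The uniformity in [th] is the point: it starts the iteration over shifts in [pos_def_div]. *)
Lemma fejer_lb (L : nat) (f : nat -> C) :
  exists B, 0 <= B /\ forall th, - B <= fejer L f th.
Proof.
exists (INR L * Cmod (f 0%N) + 2 * \sum_(1 <= l < L) (INR L * Cmod (f l))).
have hL := pos_INR L.
have re z : - Cmod z <= Re z.
  have := re_le_Cmod z; have := Rle_abs (- Re z); rewrite Rabs_Ropp; lra.
split.
  have : 0 <= \sum_(1 <= l < L) (INR L * Cmod (f l)).
    by apply: rsum_ge0 => l _ _; apply: Rmult_le_pos => //; exact: Cmod_ge_0.
  by have := Rmult_le_pos _ _ hL (Cmod_ge_0 (f 0%N)); lra.
move=> th; rewrite /fejer.
have h0 := Rmult_le_compat_l _ _ _ hL (re (f 0%N)).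
suff : -1 * \sum_(1 <= l < L) (INR L * Cmod (f l)) <=
   \sum_(1 <= l < L) ((INR L - INR l) * Re (Cmult (f l) (cis (th * INR l)))) by lra.
rewrite rsum_scal; apply: rsum_le => l /andP[_ hl] _.
have := re (Cmult (f l) (cis (th * INR l))); rewrite Cmod_mult Cmod_cis => h1.
have h2 := INR_ltn l L hl; have h3 := pos_INR l; have h4 := Cmod_ge_0 (f l).
by nra.
Qed.

(* If [f] is positive definite then so is [f / (1 - q cis (a l))]: this is the expansion
   into a geometric series, run on the Fourier side. *)
Lemma pos_def_div (L : nat) (q a : R) (f h : nat -> C) :
  0 <= q < 1 -> pos_def L f ->
  (forall l, f l = Cmult (Cminus 1 (Cmult (RtoC q) (cis (a * INR l)))) (h l)) ->
  pos_def L h.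
Proof.
move=> hq hf e.
(* Multiplication by [cis (a l)] shifts the transform by [a]. Iterating [J] times bounds it below by
   [- q^J B], which tends to 0. *)
have rec th : q * fejer L h (th + a) <= fejer L h th.
  have -> : fejer L h th = fejer L f th + q * fejer L h (th + a).
    rewrite -fejer_cis -fejerZ -fejerD; apply: eq_fejer => l.
    by rewrite e; ring.
  by have := hf th; lra.
have [B [B0 hB]] := fejer_lb L h.
have iter J th : - (q ^ J * B) <= fejer L h th.
  elim: J th => [|J IH] th; first by have := hB th; rewrite /=; lra.
  have := Rmult_le_compat_l q _ _ (proj1 hq) (IH (th + a)); have := rec th.
  by rewrite /=; lra.
move=> th; apply: Rnot_lt_le => hneg.
have [N hN] := pow_lt_1_zero q ltac:(rewrite Rabs_right; lra)
  (- fejer L h th / (B + 1)) ltac:(apply: Rdiv_lt_0_compat; lra).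
have := hN N ltac:(lia); rewrite Rabs_right; last by apply/Rle_ge/pow_le; lra.
move/Rlt_div_r => /(_ ltac:(lra)); have := iter N th; have := pow_le q N (proj1 hq).
lra.
Qed.

(** * The resonator and its place in the cone *)

Section Resonator.
Variables (q a : nat -> R).

(** The denominator is [|1 - q_p cis (a_p l)|^2] in real form; recursion on the list lets the cone
    be followed prime by prime. *)
Fixpoint resonator (s : seq nat) (l : nat) : R :=
  if s is p :: s' then
    resonator s' l / (1 - 2 * q p * cos (a p * INR l) + q p * q p)
  else 1.

Lemma res_den_lb (p l : nat) : 0 <= q p < 1 ->
  0 < (1 - q p) * (1 - q p) <= 1 - 2 * q p * cos (a p * INR l) + q p * q p.
Proof. by move=> hq; have := COS_bound (a p * INR l); nra. Qed.

(** The sign [sg = 1] or [-1] selects one of two conjugate factors of the denominator, each of the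
    shape divided out by [pos_def_div]. *)
Definition res_fac (sg : R) (p l : nat) : C :=
  Cminus 1 (Cmult (RtoC (q p)) (cis (sg * a p * INR l))).

Lemma resonator_cons (p : nat) (s : seq nat) (l : nat) : 0 <= q p < 1 ->
  RtoC (resonator s l) =
  Cmult (res_fac (-1) p l) (Cmult (res_fac 1 p l) (RtoC (resonator (p :: s) l))).
Proof.
move=> hq; have := res_den_lb p l hq; rewrite /=.
set x := a p * INR l; set d := 1 - _ + _ => hd.
rewrite Cmult_assoc.
have -> : Cmult (res_fac (-1) p l) (res_fac 1 p l) = RtoC d.
  rewrite /res_fac (_ : -1 * a p * INR l = - x); last by rewrite /x; lra.
  rewrite (_ : 1 * a p * INR l = x); last by rewrite /x; lra.
  rewrite /cis cos_neg sin_neg /Cminus /Cplus /Copp /Cmult /RtoC /=.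
  have h := sin2_cos2 x; rewrite /Rsqr in h.
  congr pair; last by lra.
  have -> : d = 1 - 2 * q p * cos x + q p * q p * (sin x * sin x + cos x * cos x).
    by rewrite h /d; lra.
  lra.
by rewrite -RtoC_mult; congr RtoC; field; lra.
Qed.

Lemma pos_def_cons (L : nat) (u : nat -> C) (p : nat) (s : seq nat) : 0 <= q p < 1 ->
  pos_def L (fun l => Cmult (u l) (RtoC (resonator s l))) ->
  pos_def L (fun l => Cmult (u l) (RtoC (resonator (p :: s) l))).
Proof.
move=> hq H.
have H1 : pos_def L
   (fun l => Cmult (u l) (Cmult (res_fac 1 p l) (RtoC (resonator (p :: s) l)))).
  apply: (pos_def_div L (q p) (-1 * a p) _ _ hq H) => l.
  by rewrite (resonator_cons p) // -/(res_fac (-1) p l); ring.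
apply: (pos_def_div L (q p) (1 * a p) _ _ hq H1) => l.
by rewrite -/(res_fac 1 p l); ring.
Qed.

Lemma pos_def_resonator (L : nat) (s : seq nat) :
  (forall p, p \in s -> 0 <= q p < 1) -> pos_def L (fun l => RtoC (resonator s l)).
Proof.
move=> hs; apply: (eq_pos_def L (fun l => Cmult 1 (RtoC (resonator s l)))).
  by move=> l; rewrite Cmult_1_l.
elim: s hs => [|p s IH] hs.
  by apply: eq_pos_def (pos_def1 L) => l; rewrite Cmult_1_l.
apply: pos_def_cons; first by apply: hs; rewrite mem_head.
by apply: IH => r hr; apply: hs; rewrite inE hr orbT.
Qed.

(** If [f = (1 - q e) h], then [(1 - q e) (h - 1) = (f - 1) + q e], which lies in the cone when
    [f - 1] does; this is applied once per conjugate factor. *)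
Lemma pos_def_resonator_sub1 (L : nat) (s : seq nat) :
  (forall p, p \in s -> 0 <= q p < 1) ->
  pos_def L (fun l => Cminus (RtoC (resonator s l)) 1).
Proof.
elim: s => [|p s IH] hs.
  apply: eq_pos_def (pos_defZ L 0 _ (Rle_refl 0) (pos_def1 L)) => l /=.
  by ring.
have hq : 0 <= q p < 1 by apply: hs; rewrite mem_head.
have {}IH := IH (fun r hr => hs r ltac:(by rewrite inE hr orbT)).
have Hc b : pos_def L (fun l => Cmult (RtoC (q p)) (Cmult (cis (b * INR l)) 1)).
  by apply: pos_defZ; [lra | apply: pos_def_cis; exact: pos_def1].
have H1 : pos_def L
   (fun l => Cminus (Cmult (res_fac 1 p l) (RtoC (resonator (p :: s) l))) 1).
  apply: (pos_def_div L (q p) (-1 * a p) _ _ hq (pos_defD L _ _ IH (Hc (-1 * a p)))) => l.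
  by rewrite (resonator_cons p s l hq) /res_fac; ring.
apply: (pos_def_div L (q p) (1 * a p) _ _ hq (pos_defD L _ _ H1 (Hc (1 * a p)))) => l.
by rewrite /res_fac; ring.
Qed.

(* [cis (-x) - q = cis (-x) (1 - q cis x)], so the difference cancels one factor. *)
Lemma pos_def_prime (L : nat) (s : seq nat) (p : nat) :
  (forall r, r \in s -> 0 <= q r < 1) -> p \in s ->
  pos_def L (fun l => Cmult (Cminus (cis (- a p * INR l)) (RtoC (q p)))
                            (RtoC (resonator s l))).
Proof.
elim: s => // r s IH hs; rewrite inE => /orP[/eqP e|hp]; last first.
  apply: pos_def_cons; first by apply: hs; rewrite mem_head.
  by apply: IH => // t ht; apply: hs; rewrite inE ht orbT.
subst r; have hq : 0 <= q p < 1 by apply: hs; rewrite mem_head.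
have hs' : forall r, r \in s -> 0 <= q r < 1.
  by move=> r hr; apply: hs; rewrite inE hr orbT.
have H1 : pos_def L (fun l => Cmult (res_fac 1 p l) (RtoC (resonator (p :: s) l))).
  apply: (pos_def_div L (q p) (-1 * a p) _ _ hq (pos_def_resonator L s hs')) => l.
  exact: resonator_cons.
apply: eq_pos_def (pos_def_cis L (- a p) _ H1) => l.
rewrite Cmult_assoc; congr Cmult; rewrite /res_fac.
have e : Cmult (cis (- a p * INR l)) (cis (1 * a p * INR l)) = 1.
  by rewrite -cisD (_ : _ + _ = 0) ?cis0 //; lra.
have -> : Cmult (cis (- a p * INR l)) (Cminus 1 (Cmult (q p) (cis (1 * a p * INR l))))
  = Cminus (cis (- a p * INR l))
      (Cmult (q p) (Cmult (cis (- a p * INR l)) (cis (1 * a p * INR l)))) by ring.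
by rewrite e; ring.
Qed.

(** At [l = 0] every cosine is 1 and every denominator takes its least possible value
    [(1 - q)^2]. *)
Lemma resonator_range (s : seq nat) (l : nat) :
  (forall p, p \in s -> 0 <= q p < 1) -> 0 < resonator s l <= resonator s 0.
Proof.
elim: s => [|p s IH] hs; first by rewrite /=; lra.
have hq : 0 <= q p < 1 by apply: hs; rewrite mem_head.
have {}IH := IH (fun r hr => hs r ltac:(by rewrite inE hr orbT)).
have hl := res_den_lb p l hq; have h0 := res_den_lb p 0 hq.
cbn [resonator]; split; first by apply: Rdiv_lt_0_compat; lra.
have -> : 1 - 2 * q p * cos (a p * INR 0) + q p * q p = (1 - q p) * (1 - q p).
  by rewrite /= Rmult_0_r cos_0; lra.
apply: Rmult_le_compat; try lra.
  by apply/Rlt_le/Rinv_0_lt_compat; lra.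
by apply: Rinv_le_contravar; lra.
Qed.

End Resonator.

(** * Resonance *)

Definition primes_upto (Z : nat) : seq nat := [seq p <- index_iota 0 Z.+1 | prime p].

Definition zeta_res (alpha : R) (Z l : nat) : R :=
  resonator (res_p Z) (fun p => alpha * ln (INR p)) (primes_upto Z) l.

Lemma mem_primes_upto (Z p : nat) : (p \in primes_upto Z) = prime p && (p <= Z)%N.
Proof. by rewrite mem_filter mem_index_iota /= ltnS. Qed.

Lemma res_p_upto (Z p : nat) : p \in primes_upto Z -> 0 <= res_p Z p < 1.
Proof.
by rewrite mem_primes_upto => /andP[pp hp]; apply: res_p_range; rewrite prime_gt0.
Qed.

(** Induction on [k = p m], writing [e_k = k^(-i alpha l)]: [e_k - q_k = e_m (e_p - q_p) + q_p (e_m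
    - q_m)], and both terms times the resonator stay in the cone. *)
Lemma pos_def_smooth (alpha : R) (L Z k : nat) : (0 < k)%N -> smooth Z.+1 k ->
  pos_def L (fun l => Cmult (Cminus (cis (- (alpha * ln (INR k)) * INR l)) (RtoC (res_q Z k)))
                            (RtoC (zeta_res alpha Z l))).
Proof.
have h0 := pos_def_resonator (res_p Z) (fun p => alpha * ln (INR p)) L
  (primes_upto Z) (res_p_upto Z).
elim/ltn_ind: k => k IH k0 hk.
case: (leqP k 1) => hk1.
  have -> : k = 1%N by lia.
  apply: eq_pos_def (pos_defZ L 0 _ (Rle_refl 0) h0) => l.
  rewrite res_q1 /= ln_1 Rmult_0_r Ropp_0 Rmult_0_l cis0; ring.
have pp := pdiv_prime hk1; set p := pdiv k in pp.
have [m em] : exists m, k = (p * m)%N.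
  by exists (k %/ p)%N; rewrite mulnC divnK // pdiv_dvd.
have p0 := prime_gt0 pp.
have m0 : (0 < m)%N by case: (m) em => //; rewrite muln0; lia.
have hp : (p <= Z)%N.
  by rewrite -ltnS; apply: (allP hk); rewrite mem_primes pp k0 pdiv_dvd.
have hm : smooth Z.+1 m.
  by apply/allP => r hr; apply: (allP hk); rewrite em primesM // hr orbT.
have hmk : (m < k)%N by rewrite em -{1}(mul1n m) ltn_pmul2r // prime_gt1.
have h1 := IH m hmk m0 hm.
have hmem : p \in primes_upto Z by rewrite mem_primes_upto pp.
have h2 := pos_def_prime (res_p Z) (fun p => alpha * ln (INR p)) L _ p
  (res_p_upto Z) hmem.
have hq := res_p_upto Z p hmem.
have h3 := pos_defD L _ _ (pos_def_cis L (- (alpha * ln (INR m))) _ h2)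
  (pos_defZ L (res_p Z p) _ (proj1 hq) h1).
apply: eq_pos_def h3 => l.
rewrite -/(zeta_res alpha Z l) em res_qM // (res_q_prime Z p) // RtoC_mult INR_muln.
rewrite ln_mult; [|exact: INR_gt0|exact: INR_gt0].
have -> : - (alpha * (ln (INR p) + ln (INR m))) * INR l
  = - (alpha * ln (INR m)) * INR l + - (alpha * ln (INR p)) * INR l by lra.
by rewrite cisD; ring.
Qed.

Lemma fejer_at0 (L : nat) (b c : R) (F : nat -> R) :
  fejer L (fun l => Cmult (Cminus (cis (- b * INR l)) (RtoC c)) (RtoC (F l))) 0
  = INR L * ((1 - c) * F 0%N)
    + 2 * \sum_(1 <= l < L) ((INR L - INR l) * ((cos (b * INR l) - c) * F l)).
Proof.
rewrite /fejer; congr (_ + 2 * _).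
  by rewrite /= Rmult_0_r cos_0; lra.
apply: eq_bigr => l _; rewrite Rmult_0_l cis0 Cmult_1_r.
have -> : - b * INR l = - (b * INR l) by lra.
by rewrite /cis cos_neg /Re /Cmult /Cminus /Cplus /Copp /=; lra.
Qed.

(** For [k] not smooth the coefficient is 0, and the resonator times a character is already in the
    cone. *)
Lemma resonance_term (alpha : R) (L Z k : nat) : (0 < k)%N ->
  let c := if smooth Z.+1 k then res_q Z k else 0 in
  0 <= INR L * ((1 - c) * zeta_res alpha Z 0)
    + 2 * \sum_(1 <= l < L) ((INR L - INR l)
        * ((cos (alpha * ln (INR k) * INR l) - c) * zeta_res alpha Z l)).
Proof.
move=> k0 c; rewrite -(fejer_at0 L _ c (zeta_res alpha Z)).
rewrite /c; case: (boolP (smooth Z.+1 k)) => hk; first exact: pos_def_smooth.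
have h0 := pos_def_resonator (res_p Z) (fun p => alpha * ln (INR p)) L
  (primes_upto Z) (res_p_upto Z).
apply: (eq_pos_def L _ _ _ (pos_def_cis L (- (alpha * ln (INR k))) _ h0)) => l.
rewrite /zeta_res; ring.
Qed.

Definition cos_sum (alpha : R) (X l : nat) : R :=
  \sum_(1 <= k < X.+1) (/ INR k * cos (alpha * ln (INR k) * INR l)).

(** [resonance_term] is weighted by [1/k], summed over [k <= X], and the two sums are exchanged. *)
Lemma resonance_mean (alpha : R) (L Z X : nat) :
  let Q := smooth_sum (res_f Z) Z.+1 X in
  0 <= INR L * ((harmonic X - Q) * zeta_res alpha Z 0)
    + 2 * \sum_(1 <= l < L) ((INR L - INR l)
        * ((cos_sum alpha X l - Q) * zeta_res alpha Z l)).
Proof.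
move=> Q; pose c k := if smooth Z.+1 k then res_q Z k else 0.
have eQ : Q = \sum_(1 <= k < X.+1) (/ INR k * c k).
  rewrite /Q /smooth_sum big_mkcond; apply: eq_bigr => k _.
  by rewrite /c /res_f; case: ifP => _; lra.
pose T k := / INR k * (INR L * ((1 - c k) * zeta_res alpha Z 0)
    + 2 * \sum_(1 <= l < L) ((INR L - INR l)
        * ((cos (alpha * ln (INR k) * INR l) - c k) * zeta_res alpha Z l))).
have hT : 0 <= \sum_(1 <= k < X.+1) T k.
  apply: rsum_ge0 => k /andP[k0 _] _; apply: Rmult_le_pos; last exact: resonance_term.
  by apply/Rlt_le/Rinv_0_lt_compat/INR_gt0.
apply: Rle_trans hT _; apply: Req_le.
have -> : \sum_(1 <= k < X.+1) T k =
   \sum_(1 <= k < X.+1) (INR L * zeta_res alpha Z 0 * (/ INR k - / INR k * c k))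
   + \sum_(1 <= k < X.+1) (2 * \sum_(1 <= l < L) ((INR L - INR l)
        * ((/ INR k * cos (alpha * ln (INR k) * INR l) - / INR k * c k)
            * zeta_res alpha Z l))).
  rewrite -rsum_split; apply: eq_bigr => k _; rewrite /T Rmult_plus_distr_l.
  congr (_ + _); first by lra.
  rewrite -Rmult_assoc (Rmult_comm (/ INR k)) Rmult_assoc rsum_scal; congr (_ * _).
  by apply: eq_bigr => l _; lra.
rewrite -rsum_scal rsum_sub -eQ -rsum_scal exchange_big /=.
congr (_ + 2 * _); first by rewrite /harmonic; lra.
apply: eq_bigr => l _; rewrite /cos_sum eQ -rsum_sub.
rewrite [in RHS]Rmult_comm [in RHS]Rmult_assoc (Rmult_comm _ (_ * _)).
rewrite rsum_scal; apply: eq_bigr => k _; lra.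
Qed.

Lemma fejer_weight_sum (L : nat) :
  INR L + 2 * \sum_(1 <= l < L) (INR L - INR l) = INR L * INR L.
Proof.
have := fejer_kernel L 0.
rewrite (eq_bigr (fun l => INR L - INR l)); last first.
  by move=> l _; rewrite Rmult_0_l cos_0; lra.
rewrite (eq_bigr (fun=> 1) (F1 := fun j => cos _)); last first.
  by move=> l _; rewrite Rmult_0_l cos_0.
rewrite (eq_bigr (fun=> 0) (F1 := fun j => sin _)); last first.
  by move=> l _; rewrite Rmult_0_l sin_0.
by rewrite !rsum_const // /Rsqr /= => ->; lra.
Qed.

(** The transform of [R - 1] at [th = 0] is nonnegative, so the total weight is at least that of the
    constant 1, whatever [Z] is. *)
Lemma resonance_mass (alpha : R) (L Z : nat) :
  INR L * INR L <= INR L * zeta_res alpha Z 0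
    + 2 * \sum_(1 <= l < L) ((INR L - INR l) * zeta_res alpha Z l).
Proof.
have := pos_def_resonator_sub1 (res_p Z) (fun p => alpha * ln (INR p)) L
  (primes_upto Z) (res_p_upto Z) 0.
rewrite -fejer_weight_sum /fejer.
rewrite (eq_bigr (fun l => (INR L - INR l) * zeta_res alpha Z l - (INR L - INR l))).
  by rewrite rsum_sub -/(zeta_res alpha Z 0) /Re /=; lra.
by move=> l _; rewrite Rmult_0_l cis0 /zeta_res /Re /=; lra.
Qed.

Lemma cos_sum_le (alpha : R) (X l : nat) : cos_sum alpha X l <= harmonic X.
Proof.
apply: rsum_le => k /andP[k0 _] _.
have := Rinv_0_lt_compat _ (INR_gt0 k k0).
by have := COS_bound (alpha * ln (INR k) * INR l); nra.
Qed.

Lemma zeta_res_range (alpha : R) (Z l : nat) :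
  0 < zeta_res alpha Z l <= zeta_res alpha Z 0.
Proof. exact: resonator_range (res_p_upto Z). Qed.

(** If no such [l] existed, the range [[A, L)] would contribute at most minus its own mass. The
    total mass is at least [L^2], while the terms [|l| < A] amount to at most
    [2 A L R(0) (harmonic X + 1)], contradicting the hypothesis. *)
Lemma resonance (alpha : R) (A L Z X : nat) : (0 < A <= L)%N ->
  2 * INR A * zeta_res alpha Z 0 * (harmonic X + 1) < INR L ->
  exists l : nat, (A <= l < L)%N /\
    smooth_sum (res_f Z) Z.+1 X - 1 <= cos_sum alpha X l.
Proof.
move=> /andP[A0 AL] hL; apply: NNPP => hn.
set Q := smooth_sum _ _ _ in hn; set F := zeta_res alpha Z in hL.
have hC l : (A <= l < L)%N -> cos_sum alpha X l - Q <= -1.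
  move=> hl; apply: Rnot_lt_le => hlt; apply: hn; exists l; split=> //; lra.
have hF l : 0 < F l <= F 0%N := zeta_res_range alpha Z l.
have hH : 0 <= harmonic X.
  apply: rsum_ge0 => k /andP[k0 _] _.
  by apply/Rlt_le/Rinv_0_lt_compat/INR_gt0.
have hQ : 0 <= Q.
  apply: rsum_ge0 => k /andP[k0 _] _.
  by apply: Rdiv_le_0_compat; [have := res_q_range Z k; lra | exact: INR_gt0].
have hm := resonance_mean alpha L Z X; rewrite -/Q -/F /= in hm.
have hM := resonance_mass alpha L Z; rewrite -/F in hM.
have L0 : 0 < INR L by apply: INR_gt0; lia.
have A1 : (1 <= A)%N by [].
rewrite (@big_cat_nat _ _ _ A 1 L _ _ A1 AL) /= in hm.
rewrite (@big_cat_nat _ _ _ A 1 L _ _ A1 AL) /= in hM.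
have c1 : \sum_(1 <= l < A) (INR L * (harmonic X * F 0%N))
   = (INR A - 1) * (INR L * (harmonic X * F 0%N)) by rewrite rsum_const.
have c2 : \sum_(1 <= l < A) (INR L * F 0%N) = (INR A - 1) * (INR L * F 0%N).
  by rewrite rsum_const.
have b1 : \sum_(1 <= l < A) ((INR L - INR l) * ((cos_sum alpha X l - Q) * F l))
   <= (INR A - 1) * (INR L * (harmonic X * F 0%N)).
  rewrite -c1; apply: rsum_le => l /andP[_ lA] _.
  have hl := INR_ltn l L (leq_trans lA AL); have hl0 := pos_INR l.
  have hc := cos_sum_le alpha X l; have := hF l => hFl.
  have k1 : (cos_sum alpha X l - Q) * F l <= harmonic X * F l.
    by apply: Rmult_le_compat_r; lra.
  have k2 : harmonic X * F l <= harmonic X * F 0%N by apply: Rmult_le_compat_l; lra.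
  have k3 : 0 <= harmonic X * F 0%N by apply: Rmult_le_pos; lra.
  apply: Rle_trans (_ : (INR L - INR l) * (harmonic X * F 0%N) <= _).
    by apply: Rmult_le_compat_l; lra.
  by apply: Rmult_le_compat_r; lra.
have b2 : \sum_(1 <= l < A) ((INR L - INR l) * F l) <= (INR A - 1) * (INR L * F 0%N).
  rewrite -c2; apply: rsum_le => l /andP[_ lA] _.
  have hl := INR_ltn l L (leq_trans lA AL); have hl0 := pos_INR l.
  have := hF l => hFl; apply: Rmult_le_compat; lra.
have b3 : \sum_(A <= l < L) ((INR L - INR l) * ((cos_sum alpha X l - Q) * F l))
   <= -1 * \sum_(A <= l < L) ((INR L - INR l) * F l).
  rewrite rsum_scal; apply: rsum_le => l /andP[lA lL] _.
  have hl := INR_ltn l L lL; have hc := hC l ltac:(by rewrite lA lL).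
  have := hF l => hFl.
  have : (cos_sum alpha X l - Q) * F l <= -1 * F l by apply: Rmult_le_compat_r; lra.
  by move/(Rmult_le_compat_l (INR L - INR l) _ _ ltac:(lra)); lra.
have b4 : INR L * ((harmonic X - Q) * F 0%N) <= INR L * (harmonic X * F 0%N).
  by apply: Rmult_le_compat_l; [lra | apply: Rmult_le_compat_r; have := hF 0%N; lra].
have fin : INR L * INR L <= INR L * (2 * INR A * F 0%N * (harmonic X + 1)).
  have : 0 <= INR L * F 0%N * (harmonic X + 1).
    by apply: Rmult_le_pos; [apply: Rmult_le_pos; have := hF 0%N; lra | lra].
  lra.
have := Rmult_le_reg_l _ _ _ L0 fin; lra.
Qed.

(** At [l = 0] the factor of [p] is [(1 - q_p)^(-2) = (Z/p)^2], so the logarithm is twice the sum in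
    [prime_sum_ln_ratio_le]. *)
Lemma zeta_res0_le (alpha : R) (Z : nat) : (2 <= Z)%N ->
  zeta_res alpha Z 0 <= exp (10 * INR Z / ln (INR Z)).
Proof.
move=> Z2; have hZ := INR_ge2 Z Z2.
have -> : zeta_res alpha Z 0
    = exp (2 * \sum_(1 <= p < Z.+1 | prime p) ln (INR Z / INR p)).
  rewrite /zeta_res.
  have -> : \sum_(1 <= p < Z.+1 | prime p) ln (INR Z / INR p)
     = \big[Rplus/0]_(p <- primes_upto Z) ln (INR Z / INR p).
    by rewrite big_filter [in RHS]big_mkcond big_ltn //= -big_mkcond Rplus_0_l.
  have : {subset primes_upto Z <= primes_upto Z} by [].
  elim: {1 3 4}(primes_upto Z) => [|p s IH] hs; first by rewrite big_nil /= Rmult_0_r exp_0.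
  rewrite big_cons Rmult_plus_distr_l exp_plus -IH; last first.
    by move=> r hr; apply: hs; rewrite inE hr orbT.
  have : p \in primes_upto Z by apply: hs; rewrite mem_head.
  rewrite mem_primes_upto => /andP[pp pZ].
  have hp := INR_dvdn_prime p pp; have hpZ := INR_leq p Z pZ.
  cbn [resonator]; rewrite [INR 0]/= Rmult_0_r cos_0.
  have -> : 2 * ln (INR Z / INR p) = ln (INR Z / INR p) + ln (INR Z / INR p) by lra.
  rewrite exp_plus exp_ln; last by apply: Rdiv_lt_0_compat; lra.
  rewrite [in RHS]Rmult_comm [LHS]/Rdiv; congr (_ * _).
  have -> : 1 - 2 * res_p Z p * 1 + res_p Z p * res_p Z p
     = (INR p / INR Z) * (INR p / INR Z) by rewrite /res_p; field; lra.
  by field; lra.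
apply: exp_le.
have lnZ : 0 < ln (INR Z) by rewrite -ln_1; apply: ln_increasing; lra.
have := prime_sum_ln_ratio_le Z (ltnW Z2) => h.
by apply/(Rle_div_r _ _ (ln (INR Z))) => //; lra.
Qed.

(** * Approximating zeta on the line Re s = 1 *)

(** Real part of [zeta_approx] at [1 + i t]: there [n^(1-s) / (1-s)] has real part
    [sin (t ln n) / t]. *)
Definition zeta_re_approx (t : R) (n : nat) : R :=
  \sum_(1 <= k < n.+1) (/ INR k * cos (t * ln (INR k))) - sin (t * ln (INR n)) / t.

Lemma cpow_neg_line1 (t : R) (n : nat) : (0 < n)%N ->
  cpow_neg n (1, t) = (/ INR n * cos (t * ln (INR n)), - (/ INR n * sin (t * ln (INR n)))).
Proof.
by move=> n0; rewrite /cpow_neg /= Rpower_Ropp Rpower_1 //; apply: INR_gt0.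
Qed.

Lemma Re_zeta_approx (t : R) (n : nat) : 0 < t -> (0 < n)%N ->
  Re (zeta_approx (1, t) n) = zeta_re_approx t n.
Proof.
move=> t0 n0; have hn := INR_gt0 n n0; rewrite /zeta_approx /zeta_re_approx.
have hs m : Re (sum_n_m (fun k => cpow_neg k (1, t)) 1 m)
   = \sum_(1 <= k < m.+1) (/ INR k * cos (t * ln (INR k))).
  elim: m => [|m IH]; first by rewrite sum_n_m_zero ?big_geq //; lia.
  rewrite sum_n_Sm; last by lia.
  by rewrite rsum_nat_recr // -IH cpow_neg_line1.
rewrite -hs cpow_neg_line1 // /Re /Cminus /Cplus /Copp /Cdiv /Cmult /Cinv /=.
congr (_ + _); field; lra.
Qed.

Lemma cos_log_diff (t x y : R) : 0 < t -> 0 < x <= y ->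
  Rabs (cos (t * ln y) / y - cos (t * ln x) / x) <= (t + 1) / (x * x) * (y - x).
Proof.
move=> t0 [x0 xy].
pose f u := cos (t * ln u) / u.
pose df u := (- t * sin (t * ln u) - cos (t * ln u)) / (u * u).
have dfE u : 0 < u -> is_derive f u (df u).
  by move=> u0; rewrite /f /df; auto_derive; [split; lra | field; lra].
have hmin u : Rmin x y <= u <= Rmax x y -> 0 < u.
  by rewrite /Rmin; case: Rle_dec; lra.
have [c [hc e]] := MVT_gen f x y df
  (fun u hu => dfE u (hmin u (conj (Rlt_le _ _ (proj1 hu)) (Rlt_le _ _ (proj2 hu)))))
  (fun u hu => @derivable_continuous_pt f u
     (ex_derive_Reals_0 _ _ (ex_intro _ _ (dfE u (hmin u hu))))).
have {}hc : x <= c by move: hc; rewrite /Rmin; case: Rle_dec; lra.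
rewrite -/(f y) -/(f x) e Rabs_mult (Rabs_right (y - x)); last by lra.
apply: Rmult_le_compat_r; first by lra.
rewrite /df Rabs_div; last by nra.
rewrite (Rabs_right (c * c)); last by nra.
apply: Rmult_le_compat; first exact: Rabs_pos.
- by apply/Rlt_le/Rinv_0_lt_compat; nra.
- have h1 := SIN_bound (t * ln c); have h2 := COS_bound (t * ln c).
  by apply: Rabs_le; nra.
by apply: Rinv_le_contravar; nra.
Qed.

(** With [g(u) = cos (t ln u) / u] the increment is [g(n+1)] minus the integral of [g] over
    [[n, n+1]], that is [g(n+1) - g(c)]. The bound is put in telescoping form, using
    [n + 1 <= 2n]. *)
Lemma zeta_re_approx_step (t : R) (n : nat) : 0 < t -> (0 < n)%N ->
  Rabs (zeta_re_approx t n.+1 - zeta_re_approx t n)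
  <= 2 * (t + 1) * (/ INR n - / INR n.+1).
Proof.
move=> t0 n0; have hn := INR_ge1 n n0; have hS : INR n.+1 = INR n + 1 by rewrite S_INR.
pose f u := sin (t * ln u) / t.
pose df u := cos (t * ln u) / u.
have dfE u : 0 < u -> is_derive f u (df u).
  by move=> u0; rewrite /f /df; auto_derive; [lra | field; lra].
have hmin u : Rmin (INR n) (INR n.+1) <= u <= Rmax (INR n) (INR n.+1) -> 0 < u.
  by rewrite /Rmin; case: Rle_dec; lra.
have [c [hc e]] := MVT_gen f (INR n) (INR n.+1) df
  (fun u hu => dfE u (hmin u (conj (Rlt_le _ _ (proj1 hu)) (Rlt_le _ _ (proj2 hu)))))
  (fun u hu => @derivable_continuous_pt f u
     (ex_derive_Reals_0 _ _ (ex_intro _ _ (dfE u (hmin u hu))))).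
have {}hc : INR n <= c <= INR n.+1.
  by move: hc; rewrite /Rmin /Rmax; case: Rle_dec; lra.
have -> : zeta_re_approx t n.+1 - zeta_re_approx t n = df (INR n.+1) - df c.
  have e2 : f (INR n.+1) - f (INR n) = df c by rewrite e hS; lra.
  rewrite /zeta_re_approx rsum_nat_recr // -/(f (INR n.+1)) -/(f (INR n)).
  by rewrite /df in e2 *; rewrite -e2; lra.
apply: Rle_trans (cos_log_diff t c (INR n.+1) t0 _) _; first by lra.
have -> : 2 * (t + 1) * (/ INR n - / INR n.+1)
   = (t + 1) * (2 * (/ INR n * / INR n.+1)) by rewrite hS; field; lra.
have h1 : / (c * c) <= / (INR n * INR n) by apply: Rinv_le_contravar; nra.
have h2 : / INR n <= 2 * / INR n.+1.
  have -> : 2 * / INR n.+1 = / (INR n.+1 / 2) by field; lra.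
  by apply: Rinv_le_contravar; lra.
have hin : 0 < / INR n by apply: Rinv_0_lt_compat; lra.
rewrite /Rdiv Rmult_assoc; apply: Rmult_le_compat_l; first by lra.
have hcc : 0 < / (c * c) by apply: Rinv_0_lt_compat; nra.
rewrite (Rinv_mult (INR n)) in h1.
have h3 : / (c * c) * (INR n.+1 - c) <= / (c * c) * 1 by apply: Rmult_le_compat_l; lra.
have h4 : / INR n * / INR n <= / INR n * (2 * / INR n.+1) by apply: Rmult_le_compat_l; lra.
lra.
Qed.

Lemma zeta_re_approx_close (t : R) (n m : nat) : 0 < t -> (0 < n <= m)%N ->
  Rabs (zeta_re_approx t m - zeta_re_approx t n) <= 2 * (t + 1) / INR n.
Proof.
move=> t0 /andP[n0 nm].
suff : Rabs (zeta_re_approx t m - zeta_re_approx t n)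
    <= 2 * (t + 1) * (/ INR n - / INR m).
  have h : 0 < / INR m by apply/Rinv_0_lt_compat/INR_gt0; lia.
  by have := Rmult_lt_0_compat (2 * (t + 1)) _ ltac:(lra) h; rewrite /Rdiv; lra.
move: nm => /subnK <-; elim: (m - n)%N => [|k IH].
  by rewrite add0n Rminus_eq_0 Rabs_R0; lra.
rewrite addSn; have h := zeta_re_approx_step t (k + n)%N t0 ltac:(lia).
set u := zeta_re_approx t in IH h *.
have -> : u (k + n).+1 - u n = (u (k + n).+1 - u (k + n)%N) + (u (k + n)%N - u n) by lra.
by apply: Rle_trans (Rabs_triang _ _) _; lra.
Qed.

(** The Cauchy criterion shows that the limit in [zeta] is finite, so taking [real] of it is
    harmless; the bound valid for all indices from [X] on then passes to the limit. *)
Lemma Re_zeta_lb (t : R) (X : nat) : 0 < t -> (0 < X)%N ->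
  \sum_(1 <= k < X.+1) (/ INR k * cos (t * ln (INR k))) - / t - 2 * (t + 1) / INR X
  <= Re (zeta (1, t)).
Proof.
move=> t0 X0; pose u n := Re (zeta_approx (1, t) n).
have uE n : (0 < n)%N -> u n = zeta_re_approx t n by exact: Re_zeta_approx.
have [l hl] : ex_finite_lim_seq u.
  apply/ex_lim_seq_cauchy_corr => eps.
  have [N hN] := nfloor_ex (2 * (2 * (t + 1)) / eps)
    ltac:(by apply: Rdiv_le_0_compat; [lra | exact: cond_pos]).
  have he := cond_pos eps.
  have hN1 : 2 * (t + 1) / INR N.+1 < eps / 2.
    have hS := S_INR N; have hp := INR_gt0 N.+1 isT.
    apply/Rlt_div_l => //; case: hN => _; rewrite -hS => /Rlt_div_l.
    by move/(_ he); lra.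
  exists N.+1 => n m hn hm.
  have h1 := zeta_re_approx_close t N.+1 n t0 ltac:(lia).
  have h2 := zeta_re_approx_close t N.+1 m t0 ltac:(lia).
  rewrite !uE; [|lia|lia].
  have -> : zeta_re_approx t n - zeta_re_approx t m =
    (zeta_re_approx t n - zeta_re_approx t N.+1)
    + - (zeta_re_approx t m - zeta_re_approx t N.+1) by lra.
  by apply: Rle_lt_trans (Rabs_triang _ _) _; rewrite Rabs_Ropp; lra.
have -> : Re (zeta (1, t)) = l.
  by rewrite /zeta /= -/u (is_lim_seq_unique _ _ hl).
pose b := zeta_re_approx t X - 2 * (t + 1) / INR X.
have hle : b <= l.
  have hb n : b <= u (n + X)%coq_nat.
    rewrite uE; last by lia.
    have := zeta_re_approx_close t X (n + X)%coq_nat t0 ltac:(lia).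
    by move/Rabs_le_between; rewrite /b; lra.
  by have := is_lim_seq_le _ _ b l hb (is_lim_seq_const b)
    (proj1 (is_lim_seq_incr_n u X l) hl).
apply: Rle_trans hle; rewrite /b /zeta_re_approx.
have h : sin (t * ln (INR X)) / t <= / t.
  rewrite -[X in _ <= X]Rmult_1_l; apply: Rmult_le_compat_r.
    by apply/Rlt_le/Rinv_0_lt_compat.
  by have := SIN_bound (t * ln (INR X)); lra.
lra.
Qed.

(** * Choice of parameters *)

(** The exponential is a seventh power with base [exp (3u/56) >= u/20], one power more than
    needed. *)
Lemma exp_dominates_pow6 (u : R) : 24 * 20 ^ 7 < u -> 24 * u ^ 6 < exp (3 * u / 8).
Proof.
move=> hu.
have u0 : 0 < u by lra.
have h : (u / 20) ^ 7 <= exp (3 * u / 8).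
  have -> : exp (3 * u / 8) = exp (3 * u / 56) ^ 7.
    by rewrite -Rpower_pow ?/Rpower ?ln_exp; [congr exp; rewrite /=; lra | exact: exp_pos].
  by apply: pow_incr; have := exp_ineq1_le (3 * u / 56); lra.
apply: Rlt_le_trans h.
have -> : (u / 20) ^ 7 = u ^ 6 * (u / 20 ^ 7) by field.
by rewrite Rmult_comm; apply: Rmult_lt_compat_l; [apply: pow_lt | lra].
Qed.

(* [Z = floor (c log N loglog N)] with [c = 1/80] keeps [zeta_res alpha Z 0] below [N^(1/8)]. *)
Lemma resonator_length (u : R) : exp 160 <= u ->
  exists Z : nat, (2 <= Z)%N /\ INR Z + 1 <= u * u /\
    10 * INR Z / ln (INR Z) <= u / 8 /\ ln u + ln (ln u) - ln 160 <= ln (INR Z).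
Proof.
move=> hu.
have u160 : 160 < u by have := exp_ineq1_le 160; lra.
have hv : 160 <= ln u by rewrite -(ln_exp 160); apply: ln_le => //; exact: exp_pos.
have hvu : ln u <= u - 1 by apply: ln_le_sub1; lra.
set v := ln u in hv hvu *.
have hx : 0 <= u * v / 80 by nra.
have [Z [hZ1 hZ2]] := nfloor_ex _ hx.
(* As [v >= 160], [u v / 80 >= 2 u]. Hence [ln Z >= v], which gives the bound [u/8]; rounding down
   is absorbed by passing from 80 to 160. *)
have hZu : u <= INR Z by nra.
have hZv : v <= ln (INR Z) by apply: ln_le; lra.
exists Z; split; [|split; [|split]].
- by apply/leP; apply: INR_le; rewrite /=; lra.
- nra.
- apply/Rle_div_l; first by lra.
  have := Rmult_le_compat_l (u / 8) _ _ ltac:(lra) hZv; lra.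
rewrite -ln_mult; [|lra|lra]; rewrite -ln_div; [|nra|lra].
by apply: ln_le; nra.
Qed.

Lemma zeta_line1_large_values (alpha : R) : 0 < alpha ->
  exists U : R, forall N : nat, U <= ln (INR N) ->
    exists l : nat,
      sqrt (INR N) <= INR l /\ INR l <= INR N * ln (INR N) /\
      exp euler_gamma * (ln (ln (INR N)) + ln (ln (ln (INR N))) - (16 + ln 160))
        <= Cmod (zeta (1, alpha * INR l)).
Proof.
move=> ha.
(* The first two terms serve [resonator_length] and [exp_dominates_pow6]; [2/alpha] makes the pole
   term at most 1, and [2 (alpha + 1)] does the same for the tail of zeta. *)
exists (exp 160 + 24 * 20 ^ 7 + 2 / alpha + 2 * (alpha + 1) + 1) => N hU.
have he := exp_pos 160.
have hia : 0 < 2 / alpha by apply: Rdiv_lt_0_compat; lra.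
have hp : 0 < 24 * 20 ^ 7 by lra.
have N0 : (0 < N)%N.
  by case: N hU => //; rewrite /= ln_zero; lra.
have hN := INR_gt0 N N0; set u := ln (INR N) in hU *.
have [Z [Z2 [hZu [hF hlnZ]]]] := resonator_length u ltac:(lra).
have u1 : 160 < u by have := exp_ineq1_le 160; lra.
have NE : INR N = exp u by rewrite exp_ln.
have hNu : u <= INR N by rewrite NE; have := exp_ineq1_le u; lra.
pose S := sqrt (INR N).
have SS : S * S = INR N by apply: sqrt_sqrt; lra.
have SE : S = exp (u / 2).
  rewrite /S NE (_ : u = u / 2 + u / 2); last by lra.
  by rewrite exp_plus sqrt_square; [congr exp; lra | apply/Rlt_le/exp_pos].
have Su : u / 2 <= S by rewrite SE; have := exp_ineq1_le (u / 2); lra.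
have [a0 [ha1 ha2]] := nfloor_ex S ltac:(lra).
pose A := a0.+1; have hA : INR A = INR a0 + 1 by rewrite /A S_INR.
(* The first factor is the length required by [res_sum_lb], and [N^2] controls the tail of zeta;
   [ln X] stays polynomial in [u]. *)
pose X := (expn Z.+1 (Z.+1 * (2 * Z.+1)) * (N * N))%N.
have NN0 : (0 < N * N)%N by rewrite muln_gt0 N0.
have hX1 : (expn Z.+1 (Z.+1 * (2 * Z.+1)) <= X)%N by rewrite leq_pmulr.
have hX2 : (N * N <= X)%N by rewrite leq_pmull // expn_gt0.
have X0 : (0 < X)%N by apply: leq_trans hX2.
pose w := INR Z.+1; have hw : w = INR Z + 1 by rewrite /w S_INR.
have hw1 : 0 < w by apply: INR_gt0.
have hH : harmonic X + 1 <= 6 * u ^ 6.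
  have h1 := harmonic_le_ln X X0.
  have h2 : ln (INR X) = w * (2 * w) * ln w + 2 * u.
    rewrite /X INR_muln ln_mult; [|by apply: INR_gt0; rewrite expn_gt0|exact: INR_gt0].
    rewrite INR_expn ln_pow_nat // !INR_muln ln_mult // -/u -/w.
    by rewrite (_ : INR 2 = 2) //; lra.
  have h3 : ln w <= w by have := ln_le_sub1 w hw1; lra.
  have h4 : w * (2 * w) * ln w <= 2 * w ^ 3.
    have -> : 2 * w ^ 3 = w * (2 * w) * w by ring.
    by apply: Rmult_le_compat_l => //; nra.
  have h5 : w ^ 3 <= u ^ 6.
    have -> : u ^ 6 = (u * u) ^ 3 by ring.
    by apply: pow_incr; lra.
  have h6 : u <= u ^ 6.
    have -> : u ^ 6 = u * u ^ 5 by ring.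
    have : 1 <= u ^ 5 by apply: pow_R1_Rle; lra.
    nra.
  lra.
have hF0 : zeta_res alpha Z 0 <= exp (u / 8).
  by apply: Rle_trans (zeta_res0_le alpha Z Z2) (exp_le _ _ hF).
(* Of [N = exp u], the range below [sqrt N] uses [exp (u/2)] and the resonator [exp (u/8)]; the
   remaining [exp (3u/8)] beats [24 u^6]. *)
have hmain : 2 * INR A * zeta_res alpha Z 0 * (harmonic X + 1) < INR N.
  have hz := zeta_res_range alpha Z 0.
  have hA2 : 2 * INR A <= 4 * S by lra.
  have hA0 : 0 < INR A by apply: INR_gt0.
  have hH0 : 0 <= harmonic X.
    apply: rsum_ge0 => k /andP[k0 _] _.
    by apply/Rlt_le/Rinv_0_lt_compat/INR_gt0.
  apply: Rle_lt_trans (_ : 4 * S * exp (u / 8) * (6 * u ^ 6) < _).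
    apply: Rmult_le_compat; [apply: Rmult_le_pos; lra | lra | | exact: hH].
    by apply: Rmult_le_compat; lra.
  have h24 := exp_dominates_pow6 u ltac:(lra).
  have -> : INR N = S * exp (u / 8) * exp (3 * u / 8).
    by rewrite NE SE -!exp_plus; congr exp; lra.
  have -> : 4 * S * exp (u / 8) * (6 * u ^ 6) = S * exp (u / 8) * (24 * u ^ 6) by ring.
  apply: Rmult_lt_compat_l => //; apply: Rmult_lt_0_compat; last exact: exp_pos.
  lra.
have hAN : (0 < A <= N)%N.
  rewrite /=; apply/leP; apply: INR_le; nra.
have [l [/andP[lA lN] hl]] := resonance alpha A N Z X hAN hmain.
have hlA := INR_leq A l lA; have hlN := INR_ltn l N lN.
exists l; split; first by rewrite -/S; lra.
split; first by nra.
have t0 : 0 < alpha * INR l by apply: Rmult_lt_0_compat; lra.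
have hz := Re_zeta_lb (alpha * INR l) X t0 X0.
have e : cos_sum alpha X l
   = \sum_(1 <= k < X.+1) (/ INR k * cos (alpha * INR l * ln (INR k))).
  by apply: eq_bigr => k _; congr (_ * cos _); lra.
rewrite -e in hz.
have ht : / (alpha * INR l) <= 1.
  rewrite -Rinv_1; apply: Rinv_le_contravar; first by lra.
  have h : / alpha <= INR l by rewrite /Rdiv in hU; lra.
  have := Rmult_le_compat_l alpha _ _ (Rlt_le _ _ ha) h.
  by rewrite Rinv_r; lra.
have htX : 2 * (alpha * INR l + 1) / INR X <= 1.
  have hXr := INR_leq _ _ hX2; rewrite INR_muln in hXr.
  apply/Rle_div_l; first exact: INR_gt0.
  have : alpha * INR l <= alpha * INR N by apply: Rmult_le_compat_l; lra.
  have : INR N * (2 * (alpha + 1)) <= INR N * INR N by apply: Rmult_le_compat_l; lra.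
  lra.
have hQ := res_sum_lb Z X Z2 hX1.
have [g0 _] := euler_gamma_spec.
have hg : 1 <= exp euler_gamma by have := exp_ineq1_le euler_gamma; lra.
apply: Rle_trans (re_le_Cmod _); apply: Rle_trans (Rle_abs _).
(* [16 = 13 + 3]: a loss of 1 each in [resonance], the pole term and the tail is absorbed because
   [exp euler_gamma >= 1]. *)
have : exp euler_gamma * (ln u + ln (ln u) - (16 + ln 160))
  <= exp euler_gamma * (ln (INR Z) - 13) - 3.
  have := Rmult_le_compat_l (exp euler_gamma) _ _ ltac:(lra) hlnZ; lra.
lra.
Qed.

End LargeValues.

Theorem theorem1p3 (alpha : R) (halpha : 0 < alpha) :
  exists K : R, exists N0 : nat, forall N : nat, (N0 <= N)%nat -> (1 <= N)%nat ->
    exists l : nat,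
      sqrt (INR N) <= INR l /\ INR l <= INR N * ln (INR N) /\
      exp euler_gamma * (ln (ln (INR N)) + ln (ln (ln (INR N))) - K)
        <= Cmod (zeta (1, alpha * INR l)).
Proof.
destruct (zeta_line1_large_values alpha halpha) as [U HU].
destruct (nfloor_ex (exp U)) as [n [_ Hn]]; [left; apply exp_pos|].
exists (16 + ln 160), (S n); intros N HN _; apply HU.
rewrite <- (ln_exp U); apply ln_le; [apply exp_pos|].
apply le_INR in HN; rewrite S_INR in HN; lra.
Qed.
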